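(* Let $\Omega\subset\mathbb{R}^n$ be open and let $E\subset\Omega$ be a relatively closed set of $(s,1)$-capacity zero. Assume that $\mathscr{B}$ is independent of its second variable and locally integrable, i.e. $\mathscr{B}(x,z)=\mathscr{B}(x)\in L^1_{\mathrm{loc}}(\Omega)$. If $u$ is a weak solution in $\Omega\setminus E$ of the equation $$-\int_{\mathbb{R}^n} \mathscr{A}\left(x,y,\frac{u(x)-u(y)}{|x-y|}\right)\frac{\mathrm{d}y}{|x-y|^{n+s}} = \mathscr{B}(x),$$ then $u$ has a representative (a function equal to $u$ almost everywhere) that is a weak solution of the same equation in all of $\Omega$.
   Context: Fix $n\in\mathbb{N}$, $s\in(0,1)$. Structural conditions. $\mathscr{A}:\mathbb{R}^n\times\mathbb{R}^n\times\mathbb{R}\to\mathbb{R}$ is a Carathéodory function (measurable in the $\mathbb{R}^n$-variables, continuous in the last variable) with $\mathscr{A}(x,y,0)=0$ for a.e. $x,y$, such that: (1) $\mathscr{A}(x,y,t_1)\le \mathscr{A}(x,y,t_2)$ if $t_1<t_2$, for a.e. $x,y\in\mathbb{R}^n$; (2) there is a constant $\Lambda>0$ with $|\mathscr{A}(x,y,t)|\le\Lambda$ for a.e. $x,y\in\mathbb{R}^n$ and every $t\in\mathbb{R}$; (3) $\inf_{x,y\in\mathbb{R}^n}\mathscr{A}(x,y,1)>0$ and $\sup_{x,y\in\mathbb{R}^n}\mathscr{A}(x,y,-1)<0$. Weak solutions. For an open set $U\subset\Omega$, a measurable function $u:\mathbb{R}^n\to\mathbb{R}$ is a weak solution of the equation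 in $U$ if $$\int_{\mathbb{R}^n}\int_{\mathbb{R}^n}\mathscr{A}\left(x,y,\frac{u(x)-u(y)}{|x-y|}\right)(\varphi(x)-\varphi(y))\frac{\mathrm{d}y\,\mathrm{d}x}{|x-y|^{n+s}}+\int_U\mathscr{B}(x)\varphi\,\mathrm{d}x=0$$ for every $\varphi\in C_c^\infty(U)$ (no regularity of $u$ besides measurability is required). Capacity. $[v]_{W^{s,1}(\mathbb{R}^n)}=\int_{\mathbb{R}^n}\int_{\mathbb{R}^n}\frac{|v(x)-v(y)|}{|x-y|^{n+s}}\,\mathrm{d}y\,\mathrm{d}x$. For open $U\subset\mathbb{R}^n$ and compact $F\subset U$, $\mathrm{cap}_{s,1}(F,U)=\inf [v]_{W^{s,1}(\mathbb{R}^n)}$ over all $v\in C_c^\infty(U)$ with $v\ge1$ on $F$. For open $G\subset U$, $\mathrm{cap}_{s,1}(G,U)=\sup\{\mathrm{cap}_{s,1}(F,U): F\subset G \text{ compact}\}$; for arbitrary $A\subset U$, $\mathrm{cap}_{s,1}(A,U)=\inf\{\mathrm{cap}_{s,1}(G,U): G\text{ open}, A\subset G\subset U\}$. A set $A\subset\mathbb{R}^n$ is of $(s,1)$-capacity zero if $\mathrm{cap}_{s,1}(A\cap U,U)=0$ for all open $U\subset\mathbb{R}^n$. *)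

(* Defs.v *)
From HB Require Import structures.
From mathcomp Require Import all_boot all_order all_algebra.
From mathcomp Require Import all_classical all_reals all_analysis.
From mathcomp Require Import measurable_realfun.
Set Implicit Arguments.
Unset Strict Implicit.
Unset Printing Implicit Defensive.
Import Order.TTheory GRing.Theory Num.Theory.
Import numFieldNormedType.Exports.

Local Open Scope classical_set_scope.
Local Open Scope ring_scope.

(* Points of R^n are row vectors ['rV[R]_n], measurable for the sigma-algebra
   generated by the coordinates, i.e. the Borel sigma-algebra. *)

Definition rV_display : measure_display. Proof. exact: default_measure_display. Qed.

Section measurable_rV.
Variables (R : realType) (n : nat).

Let coor (i : 'I_n) (x : 'rV[R]_n) : R := x ord0 i.

Let rV_set0 : g_sigma_preimage coor set0.
Proof. exact: sigma_algebra0. Qed.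

Let rV_setC A : g_sigma_preimage coor A -> g_sigma_preimage coor (~` A).
Proof. exact: sigma_algebraC. Qed.

Let rV_bigcup (F : (set _)^nat) : (forall i, g_sigma_preimage coor (F i)) ->
  g_sigma_preimage coor (\bigcup_i F i).
Proof. exact: sigma_algebra_bigcup. Qed.

HB.instance Definition _ := @isMeasurable.Build rV_display
  'rV[R]_n (g_sigma_preimage coor) rV_set0 rV_setC rV_bigcup.

Lemma measurable_coor (i : 'I_n) :
  measurable_fun [set: 'rV[R]_n] (fun x : 'rV[R]_n => x ord0 i).
Proof.
move=> _ Y mY; rewrite setTI; apply: sub_sigma_algebra => /=.
rewrite -bigcup_seq/=; exists i => /=; first by rewrite mem_index_enum.
by exists Y => //; rewrite setTI.
Qed.

Lemma measurable_rV d (T : measurableType d) (f : T -> 'rV[R]_n) :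
  (forall i, measurable_fun [set: T] (fun x => f x ord0 i)) ->
  measurable_fun [set: T] f.
Proof.
move=> mf _ Y mY; rewrite setTI.
suff: preimage_set_system [set: T] f (g_sigma_preimage coor) `<=` measurable.
  by apply; exists Y => //; rewrite setTI.
rewrite -g_sigma_preimage_comp; apply: smallest_sub.
  exact: sigma_algebra_measurable.
rewrite -bigcup_seq => _ [i _] [A mA <-]; exact: mf.
Qed.

End measurable_rV.

Section rV_cons.
Variables (R : realType) (n : nat).

Definition rV_cons (p : measurableTypeR R * 'rV[R]_n) : 'rV[R]_n.+1 :=
  row_mx (p.1 : R)%:M p.2 : 'rV[R]_(1 + n).

Lemma measurable_rV_cons : measurable_fun setT rV_cons.
Proof.
apply: measurable_rV => i.
case: (@split_ordP 1 n i) => j ->.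
- suff -> : (fun p => rV_cons p ord0 (lshift n j)) = fst by [].
  apply/funext => p; apply: etrans (row_mxEl _ _ _ _) _.
  by rewrite (ord1 j) !mxE eqxx mulr1n.
- suff -> : (fun p => rV_cons p ord0 (rshift 1 j)) =
    (fun x : 'rV[R]_n => x ord0 j) \o snd.
    by apply: measurableT_comp => //; exact: measurable_coor.
  by apply/funext => p; exact: row_mxEr.
Qed.

Definition rV_uncons (x : 'rV[R]_n.+1) : measurableTypeR R * 'rV[R]_n :=
  (x ord0 ord0, \row_j x ord0 (lift ord0 j)).

Lemma rV_consK : cancel rV_cons rV_uncons.
Proof.
case=> a v; rewrite /rV_uncons /rV_cons/=; congr (_, _).
- have -> : ord0 = @lshift 1 n ord0 by exact: val_inj.
  by apply: etrans (row_mxEl _ _ _ _) _; rewrite mxE eqxx mulr1n.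
- apply/rowP => j; rewrite mxE.
  have -> : lift ord0 j = @rshift 1 n j by exact: val_inj.
  exact: row_mxEr.
Qed.

Lemma measurable_rV_uncons : measurable_fun setT rV_uncons.
Proof.
apply/measurable_fun_pairP; split; first exact: measurable_coor.
apply: measurable_rV => i; rewrite (_ : (fun _ => _) =
  (fun x : 'rV[R]_n.+1 => x ord0 (lift ord0 i))); first exact: measurable_coor.
by apply/funext => x; rewrite /= mxE.
Qed.

End rV_cons.

Section lebesgue_rV.
Variable R : realType.

Section step.
Variables (n : nat) (m : {sigma_finite_measure set 'rV[R]_n -> \bar R}).

Definition lebesgue_rV_step : set 'rV[R]_n.+1 -> \bar R :=
  pushforward (@lebesgue_measure R \x m)%E (@rV_cons R n).

Let mf := @measurable_rV_cons R n.

HB.instance Definition _ := Measure.copy lebesgue_rV_step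
  (measure_function_pushforward__canonical__measure_function_Measure
     (@lebesgue_measure R \x m)%E mf).

Let lebesgue_rV_step_sigma_finite : sigma_finite setT lebesgue_rV_step.
Proof.
have /sigma_finiteP[F [FT ndF Foo]] := sigma_finiteT (@lebesgue_measure R).
have /sigma_finiteP[G [GT ndG Goo]] := sigma_finiteT m.
exists (fun k => @rV_uncons R n @^-1` (F k `*` G k)).
  rewrite -preimage_bigcup (_ : \bigcup_k _ = setT) ?preimage_setT//.
  apply/seteqP; split=> // -[x y] _.
  have : [set: measurableTypeR R] x by []. rewrite FT => -[i _ Fx].
  have : [set: 'rV[R]_n] y by []. rewrite GT => -[j _ Gy].
  exists (maxn i j) => //; split=> /=.
  - by move: x Fx; exact/subsetPset/ndF/leq_maxl.
  - by move: y Gy; exact/subsetPset/ndG/leq_maxr.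
move=> k; have [mF Fk] := Foo k; have [mG Gk] := Goo k.
split.
  rewrite -[X in measurable X]setTI; apply: measurable_rV_uncons => //.
  exact: measurableX.
rewrite /lebesgue_rV_step /pushforward -comp_preimage.
rewrite (_ : _ \o _ = id); last by apply/funext => p; exact: rV_consK.
by rewrite preimage_id product_measure1E// lte_mul_pinfty// ge0_fin_numE.
Qed.

HB.instance Definition _ := Measure_isSigmaFinite.Build _ _ _ lebesgue_rV_step
  lebesgue_rV_step_sigma_finite.

End step.

Fixpoint lebesgue_rV (n : nat) : {sigma_finite_measure set 'rV[R]_n -> \bar R} :=
  match n with
  | 0 => \d_(0 : 'rV[R]_0)
  | n'.+1 => lebesgue_rV_step (lebesgue_rV n')
  end.

End lebesgue_rV.

(* Measurability on [D] for the completion of [mu]: Lebesgue measurability when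
   [mu] is a Lebesgue measure.  [\int[mu]_x f x] is defined through suprema over
   Borel simple functions below the positive and negative parts of [f], so on
   such functions it coincides with the integral for the completed measure. *)
Definition completed_measurable_fun d (T : measurableType d) (R : realType)
    (mu : set T -> \bar R) (D : set T) (f : T -> R) :=
  forall Y, measurable Y -> completed_algebra_gen mu (D `&` f @^-1` Y).

Section nonlocal_equation.
Context {R : realType} {n : nat}.
Implicit Types (U F E Omega : set 'rV[R]_n) (s : R).
Implicit Types (u v phi B : 'rV[R]_n -> R) (A : 'rV[R]_n -> 'rV[R]_n -> R -> R).

Local Notation leb := (lebesgue_rV R n).

(* The norm [`| x |] of the library on ['rV[R]_n] is the sup norm. *)
Definition enorm (x : 'rV[R]_n) : R := Num.sqrt (\sum_i x ord0 i ^+ 2).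

Definition frac_kernel s (x y : 'rV[R]_n) : R := (enorm (x - y) `^ (n%:R + s))^-1.

Definition partial_deriv (i : 'I_n) (f : 'rV[R]_n -> R) : 'rV[R]_n -> R :=
  fun x => 'D_(delta_mx ord0 i) f x.

(* All iterated partial derivatives exist everywhere and are continuous. *)
Definition smooth (f : 'rV[R]_n -> R) :=
  forall l : seq 'I_n, let g := foldr partial_deriv f l in
    continuous g /\ forall x i, derivable g x (delta_mx ord0 i).

Definition fsupport (f : 'rV[R]_n -> R) := closure [set x | f x != 0].

(* C_c^oo(U), each function being extended by zero outside U. *)
Definition test_fun U : set ('rV[R]_n -> R) :=
  [set phi | [/\ smooth phi, compact (fsupport phi) & fsupport phi `<=` U]].

Definition caratheodory_fun A :=
  (forall t, completed_measurable_fun (leb \x leb)%E setT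
               (fun p : 'rV[R]_n * 'rV[R]_n => A p.1 p.2 t)) /\
  (\forall p \ae (leb \x leb)%E, continuous (A p.1 p.2)).

Definition structural_conditions A :=
  [/\ caratheodory_fun A,
      \forall p \ae (leb \x leb)%E, A p.1 p.2 0 = 0,
      \forall p \ae (leb \x leb)%E,
        forall t1 t2, t1 < t2 -> A p.1 p.2 t1 <= A p.1 p.2 t2,
      (exists2 Lambda : R, 0 < Lambda &
        \forall p \ae (leb \x leb)%E, forall t, `|A p.1 p.2 t| <= Lambda) &
      (0 < ereal_inf (range (fun p => (A p.1 p.2 1)%:E)))%E /\
      (ereal_sup (range (fun p => (A p.1 p.2 (-1))%:E)) < 0)%E].

Definition locally_integrable_rV Omega B :=
  completed_measurable_fun leb Omega B /\
  forall K, K `<=` Omega -> compact K ->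
    (\int[leb]_(x in K) `|B x|%:E < +oo)%E.

Definition weak_solution s A B U u :=
  completed_measurable_fun leb setT u /\
  forall phi, test_fun U phi ->
    (\int[leb]_x \int[leb]_y
        (A x y ((u x - u y) / enorm (x - y)) * (phi x - phi y)
           * frac_kernel s x y)%:E
     + \int[leb]_(x in U) (B x * phi x)%:E = 0)%E.

Definition gagliardo s v : \bar R :=
  (\int[leb]_x \int[leb]_y (`|v x - v y| * frac_kernel s x y)%:E)%E.

Definition cap_compact s F U : \bar R :=
  ereal_inf [set gagliardo s v |
    v in [set v | test_fun U v /\ forall x, F x -> 1 <= v x]].

Definition cap_open s G U : \bar R :=
  ereal_sup [set cap_compact s F U | F in [set F | compact F /\ F `<=` G]].

Definition cap s E U : \bar R :=
  ereal_inf [set cap_open s G U |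
    G in [set G | [/\ open G, E `<=` G & G `<=` U]]].

Definition cap_zero s E := forall U, open U -> cap s (E `&` U) U = 0%E.

End nonlocal_equation.

(* Main.v *)
Require Import Defs.
From HB Require Import structures.
From mathcomp Require Import all_boot all_order all_algebra.
From mathcomp Require Import all_classical all_reals all_analysis.
From mathcomp Require Import measurable_realfun.
From mathcomp Require Import ring lra.
Set Implicit Arguments.
Unset Strict Implicit.
Unset Printing Implicit Defensive.
Import Order.TTheory GRing.Theory Num.Theory.
Import numFieldNormedType.Exports.
Local Open Scope classical_set_scope.
Local Open Scope ring_scope.

(** The solution [u] itself works.  The flux
    [A(x, y, (u x - u y)/|x - y|)] is bounded by [Lambda], so a test function
    [psi] contributes at most [Lambda] times its Gagliardo seminorm to the
    nonlocal term, whatever [u] is.  This is the seminorm that the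
    [(s,1)]-capacity minimises, so a set of capacity zero cannot be seen by
    the equation.

    Let [phi] be a test function on [Omega].  Its support meets [E] in a
    compact set [S], and capacity zero gives a test function [eta], at least
    [1] near [S] and supported in a fixed ball, with seminorm as small as
    desired ([cap_zero_test_fun]).  Compose [eta] with a smooth, bounded and
    Lipschitz function of one variable that is [0] for [t >= 1] and [1] for
    [t = 0]: the result [cutoff eta] vanishes near [S], hence [phi * cutoff eta]
    is a test function on [Omega \ E] ([test_fun_cutoff]) and the equation
    holds for it.  The error [phi * theta], with [theta = 1 - cutoff eta], is
    controlled in both terms of the equation.

    - Nonlocal term: the seminorm of [phi * theta] is at most a constant times
      [||eta||_1] plus a constant times the seminorm of [eta]
      ([gagliardo_product_le]); the first constant exists because
      [|phi x - phi y| <= min (L |x - y|) M] makes the integral of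
      [|phi x - phi y| / |x - y|^(n+s)] in [y] bounded uniformly in [x]
      ([lipschitz_bounded_kernel_integral]).  Moreover [||eta||_1] is itself
      at most a constant times the seminorm, as [eta] vanishes on a whole cube
      at bounded distance from its support ([L1_le_gagliardo]).

    - Source term: [B * phi] is integrable, [theta] is uniformly bounded and
      small in [L^1], so the integral of [B * phi * theta] is small
      ([integral_mul_le_bounded]).

    Letting the seminorm of [eta] tend to [0] gives the equation for [phi].

    Since [A], [B] and [u] are measurable only for completed measures, the
    flux and the source are first replaced by Borel functions equal to them
    almost everywhere ([bounded_borel_flux], [completed_measurable_fun_ae]);
    integrals do not notice, because an integral of a nonnegative function is
    a supremum over simple functions, and these can be set to [0] on a null
    set ([integral_ae_congr]). *)

(** * A function of one variable that is flat at the origin *)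

Section flat.
Variable R : realType.
Implicit Types (k : nat) (t : R).

(** The factors [t^-k] are included because the family is then closed under
    derivation up to linear combinations, see [is_derive_flat]. *)
Definition flat k t : R := if 0 < t then t^-1 ^+ k * expR (- t^-1) else 0.

Lemma flat_le0 k t : t <= 0 -> flat k t = 0.
Proof. by rewrite /flat leNgt => /negbTE ->. Qed.

Lemma flat_gt0 k t : 0 < t -> flat k t = t^-1 ^+ k * expR (- t^-1).
Proof. by rewrite /flat => ->. Qed.

Lemma flat_ge0 k t : 0 <= flat k t.
Proof.
by rewrite /flat; case: ifPn => // t0; rewrite mulr_ge0 ?expR_ge0 ?exprn_ge0// invr_ge0 ltW.
Qed.

Lemma exprn_le_expR k (z : R) : 0 <= z -> z ^+ k <= k`!%:R * expR z.
Proof.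
case: k => [|k] z0; first by rewrite expr0 fact0 mul1r -expR0 ler_expR.
rewrite mulrC -ler_pdivrMr ?ltr0n ?fact_gt0//.
by apply: le_trans (expR_ge1Dxn k z0); rewrite lerDr.
Qed.

Lemma flat_bounded k t : flat k t <= k`!%:R.
Proof.
have [t0|t0] := leP t 0; first by rewrite flat_le0.
have z0 : 0 <= t^-1 by rewrite invr_ge0 ltW.
rewrite flat_gt0// expRN ler_pdivrMr ?expR_gt0//.
exact: exprn_le_expR.
Qed.

(** As [flat k t = t^2 * flat k.+2 t] for positive [t], this is what makes every
    member of the family differentiable at the origin. *)
Lemma flat_le_sqr k t : flat k t <= k.+2`!%:R * t ^+ 2.
Proof.
have [t0|t0] := leP t 0.
  by rewrite flat_le0// mulr_ge0// sqr_ge0.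
apply: le_trans (ler_wpM2r (sqr_ge0 t) (flat_bounded k.+2 t)).
rewrite !flat_gt0// 2!exprSr le_eqVlt; apply/orP; left; apply/eqP.
by field; rewrite gt_eqF.
Qed.

(** At [0] the difference quotient is at most a constant times [t], by
    [flat_le_sqr]; away from [0] this is the product rule. *)
Lemma is_derive_flat k t :
  is_derive t 1 (flat k) (flat k.+2 t - k%:R * flat k.+1 t).
Proof.
have [t0|t0|->] := ltgtP t 0.
- rewrite !flat_le0 ?ltW// mulr0 subr0.
  have N : \forall s \near t, cst 0 s = flat k s.
    by apply: filterS (lt_nbhsl t0) => s s0; rewrite flat_le0// ltW.
  exact: near_eq_is_derive N (is_derive_cst 0 t 1).
- have N : \forall s \near t, s^-1 ^+ k * expR (- s^-1) = flat k s.
    by apply: filterS (lt_nbhsr t0) => s s0; rewrite flat_gt0.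
  have D1 : is_derive t 1 (fun t => t^-1 : R) (- t ^- 2 *: 1).
    by apply: is_deriveV; rewrite ?gt_eqF.
  have D2 : is_derive t 1 (fun t => expR (- t^-1) : R) (expR (- t^-1) * - (- t ^- 2 *: 1)).
    by apply: (@is_derive1_comp _ expR (fun t => - t^-1)).
  have D3 : is_derive t 1 (fun t => t^-1 ^+ k : R) ((k%:R * t^-1 ^+ k.-1) *: (- t ^- 2 *: 1)).
    have := @is_deriveX _ _ (fun t => t^-1) k _ _ _ D1.
    by congr is_derive; apply/funext => r; rewrite exprfctE.
  apply: (near_eq_is_derive N); apply: is_derive_eq (is_deriveM D3 D2) _.
  rewrite !flat_gt0// /GRing.scale/=; case: k {D3 N} => [|k] /=.
    by rewrite !expr0 expr2; field; rewrite gt_eqF.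
  rewrite !exprS; field; by rewrite gt_eqF.
- rewrite !flat_le0// mulr0 subr0.
  suff cv : h^-1 *: ((flat k \o shift 0) (h *: 1) - flat k 0) @[h --> 0^'] --> (0 : R).
    by apply: DeriveDef; [exact: cvgP cv|exact: cvg_lim cv].
  apply: norm_cvg0.
  apply: (@squeeze_cvgr _ _ _ _ (cst 0) (fun h => k.+2`!%:R * `|h|)).
  + near=> h; rewrite normr_ge0 /= [flat k 0]flat_le0// subr0 addr0 /GRing.scale/= mulr1.
    have h0 : h != 0 by near: h; exact: nbhs_dnbhs_neq.
    rewrite normrM normfV ler_pdivrMl ?normr_gt0// (ger0_norm (flat_ge0 _ _)).
    apply: le_trans (flat_le_sqr _ _) _.
    by rewrite -(real_normK (num_real h)) expr2 mulrCA.
  + exact: cvg_cst.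
  + rewrite -[X in _ --> X](mulr0 k.+2`!%:R).
    apply: cvgMr; rewrite -[X in _ --> X](normr0 R).
    by apply: cvg_norm; apply: cvg_within_filter; exact: cvg_id.
Unshelve. all: by end_near. Qed.

Lemma continuous_flat k : continuous (flat k).
Proof.
move=> x; apply/differentiable_continuous/derivable1_diffP.
by have [] := is_derive_flat k x.
Qed.

(** The derivative of [flat 0] is [flat 2], which is at most [2! = 2]. *)
Lemma flat_lipschitz (a b : R) : `|flat 0 a - flat 0 b| <= 2 * `|a - b|.
Proof.
wlog ab : a b / b < a.
  move=> H; have [|//|->] := ltgtP b a; first exact: H.
    by move=> /H; rewrite distrC (distrC a).
  by rewrite !subrr normr0 mulr0.
have [|c cab ->] := MVT ab (fun x _ => is_derive_flat 0 x).
  by apply: continuous_subspaceT => x; exact: continuous_flat.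
rewrite normrM ler_wpM2r// mul0r subr0 ger0_norm ?flat_ge0//.
exact: flat_bounded.
Qed.

End flat.

(** * Directional derivatives *)

Section directional.
Context {R : realType} {n : nat}.
Implicit Types (f g : 'rV[R]_n -> R) (x v : 'rV[R]_n).

(** Directional derivatives are derivatives of one-variable functions, so that the
    chain rule and the mean value theorem on the line become available. *)
Lemma is_derive_line f x v (t D : R) :
  is_derive (t *: v + x) v f D -> is_derive t 1 (fun s => f (s *: v + x)) D.
Proof.
have E : (fun h : R => h^-1 *: (((fun s => f (s *: v + x)) \o shift t) (h *: 1) - f (t *: v + x))) =
  (fun h : R => h^-1 *: ((f \o shift (t *: v + x)) (h *: v) - f (t *: v + x))).
  apply/funext => h /=; congr (_ *: (f _ - _)).
  by rewrite addrA -scalerDl /GRing.scale/= mulr1.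
by move=> [df dv]; split; rewrite /derivable /derive E.
Qed.

Lemma is_derive_line0 f x v (D : R) :
  is_derive (0 : R) 1 (fun s : R => f (s *: v + x)) D -> is_derive x v f D.
Proof.
have E : (fun h : R => h^-1 *: (((fun s => f (s *: v + x)) \o shift 0) (h *: 1) - f (0 *: v + x))) =
  (fun h : R => h^-1 *: ((f \o shift x) (h *: v) - f x)).
  apply/funext => h /=; rewrite scale0r add0r addr0.
  by have -> : h *: (1 : R) = h by rewrite /GRing.scale/= mulr1.
by move=> [df dv]; split; move: df dv; rewrite /derivable /derive E.
Qed.

Lemma is_derive_comp (h : R -> R) g x v (dh dg : R) :
  is_derive (g x) 1 h dh -> is_derive x v g dg -> is_derive x v (h \o g) (dh * dg).
Proof.
move=> Dh Dg; apply: is_derive_line0.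
apply: (@is_derive1_comp _ h (fun s => g (s *: v + x))).
  by rewrite scale0r add0r.
by apply: is_derive_line; rewrite scale0r add0r.
Qed.

Lemma line_lipschitz f v (L : R) (x : 'rV[R]_n) (a : R) :
  (forall x, derivable f x v) -> (forall x, `|'D_v f x| <= L) ->
  `|f (a *: v + x) - f x| <= L * `|a|.
Proof.
move=> df bf.
pose g (s : R) := f (s *: v + x).
have Dg (t : R) : is_derive t 1 g ('D_v f (t *: v + x)).
  by apply: is_derive_line; exact: derivableP.
have Cg : continuous g.
  move=> t; apply/differentiable_continuous/derivable1_diffP.
  by have [] := Dg t.
have -> : f x = g 0 by rewrite /g scale0r add0r.
rewrite -/(g a).
have [c] : exists c, g a - g 0 = 'D_v f (c *: v + x) * (a - 0).
  have [a0|a0|->] := ltgtP a 0; last by exists 0; rewrite !subrr mulr0.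
  - have [|c _ E] := MVT a0 (fun t _ => Dg t).
      by apply: continuous_subspaceT.
    by exists c; rewrite -opprB E -mulrN opprB.
  - have [|c _ E] := MVT a0 (fun t _ => Dg t).
      by apply: continuous_subspaceT.
    by exists c.
by rewrite subr0 => ->; rewrite normrM ler_wpM2r.
Qed.

(** From [y] to [x] one coordinate at a time, each step by the mean value
    theorem. *)
Lemma partial_lipschitz f (L : R) :
  (forall x i, derivable f x (delta_mx ord0 i)) ->
  (forall i x, `|partial_deriv i f x| <= L) ->
  forall x y, `|f x - f y| <= n%:R * (L * `|x - y|).
Proof.
move=> df bf x y.
(* [z j] has its first [j] coordinates from [x] and the others from [y] *)
pose z (j : nat) : 'rV[R]_n := \row_i (if (i < j)%N then x ord0 i else y ord0 i).
have z0 : z 0%N = y by apply/rowP => i; rewrite mxE.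
have zn : z n = x by apply/rowP => i; rewrite mxE ltn_ord.
suff H j : (j <= n)%N -> `|f (z j) - f (z 0%N)| <= j%:R * (L * `|x - y|).
  by have := H n (leqnn n); rewrite zn z0.
elim: j => [_|j IH jn]; first by rewrite subrr normr0 mul0r.
rewrite -(subrKA (f (z j))).
apply: le_trans (ler_normD _ _) _.
rewrite mulrSr mulrDl addrC mul1r; apply: lerD; first exact/IH/ltnW.
pose i := Ordinal jn.
have -> : z j.+1 = (x ord0 i - y ord0 i) *: delta_mx ord0 i + z j.
  apply/rowP => k; rewrite !mxE ltnS leq_eqVlt -(inj_eq val_inj) /=.
  have [kj|kj] := eqVneq (val k) j; last first.
    have /negbTE -> : k != i by apply: contraNneq kj => ->.
    by rewrite mulr0 add0r.
  have -> : k = i by exact: val_inj.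
  by rewrite eqxx mulr1 ltnn subrK.
have L0 : 0 <= L by apply: le_trans (bf i x); exact: normr_ge0.
apply: le_trans (line_lipschitz (L := L) _ _ _ _) _; [by move=> ?; apply: df|exact: (bf i)|].
apply: ler_wpM2l => //.
have -> : x ord0 i - y ord0 i = (x - y) ord0 i by rewrite !mxE.
rewrite [leRHS]mx_normrE.
by apply: (le_trans _ (le_bigmax _ _ (ord0, i))).
Qed.

End directional.

(** * Smooth functions *)

Section smooth.
Context {R : realType} {n : nat}.
Implicit Types (f g : 'rV[R]_n -> R).

Lemma smooth_partial f i : smooth f -> smooth (partial_deriv i f).
Proof. by move=> sf l; have := sf (rcons l i); rewrite /= foldr_rcons. Qed.

Lemma smooth_continuous f : smooth f -> continuous f.
Proof. by move=> /(_ [::])[]. Qed.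

Lemma smooth_derivable f : smooth f -> forall x i, derivable f x (delta_mx ord0 i).
Proof. by move=> /(_ [::])[]. Qed.

(** Smoothness is the largest property of continuous functions with directional
    derivatives that is inherited by the partial derivatives. *)
Lemma smooth_coind (P : set ('rV[R]_n -> R)) :
  (forall f, P f -> [/\ continuous f, forall x i, derivable f x (delta_mx ord0 i)
    & forall i, P (partial_deriv i f)]) ->
  forall f, P f -> smooth f.
Proof.
move=> H f Pf l.
suff : P (foldr partial_deriv f l) by move=> /H[].
by elim: l => //= i l /H[_ _]; exact.
Qed.

(** Products and compositions of smooth functions have partial derivatives of
    growing complexity, so an induction on the order of derivation needs a class
    stable under sums, products and composition with the whole family [flat].
    It contains no function that is not smooth, by [smooth_coind]. *)
Inductive flat_closure : ('rV[R]_n -> R) -> Prop :=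
| flat_closure_smooth f of smooth f : flat_closure f
| flat_closure_cst (c : R) : flat_closure (cst c)
| flat_closure_add f g of flat_closure f & flat_closure g :
    flat_closure (fun x => f x + g x)
| flat_closure_mul f g of flat_closure f & flat_closure g :
    flat_closure (fun x => f x * g x)
| flat_closure_flat k f of flat_closure f : flat_closure (flat k \o f).

Lemma flat_closure_step f : flat_closure f ->
  [/\ continuous f, forall x i, derivable f x (delta_mx ord0 i)
    & forall i, flat_closure (partial_deriv i f)].
Proof.
elim=> [{}f sf|c|{}f g cf [Cf Df Pf] cg [Cg Dg Pg]|
  {}f g cf [Cf Df Pf] cg [Cg Dg Pg]|k {}f cf [Cf Df Pf]].
- split; [exact: smooth_continuous|exact: smooth_derivable|].
  by move=> i; apply: flat_closure_smooth; exact: smooth_partial.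
- split; [exact: cst_continuous|by move=> x i; exact: derivable_cst|move=> i].
  rewrite (_ : partial_deriv i _ = cst 0); first exact: flat_closure_cst.
  by apply/funext => x; exact: derive_cst.
- split.
  + by move=> x; exact: (cvgD (Cf x) (Cg x)).
  + by move=> x i; exact: derivableD.
  + move=> i; rewrite (_ : partial_deriv i _ =
      (fun x => partial_deriv i f x + partial_deriv i g x)).
      exact: flat_closure_add.
    by apply/funext => x; rewrite /partial_deriv deriveD.
- split.
  + by move=> x; exact: (cvgM (Cf x) (Cg x)).
  + by move=> x i; exact: derivableM.
  + move=> i; rewrite (_ : partial_deriv i _ =
      (fun x => f x * partial_deriv i g x + g x * partial_deriv i f x)).
      by apply: flat_closure_add; apply: flat_closure_mul.
    by apply/funext => x; rewrite /partial_deriv deriveM.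
- have D x i := is_derive_comp (is_derive_flat k (f x)) (derivableP (Df x i)).
  split.
  + by move=> x; apply: continuous_comp; [exact: Cf|exact: continuous_flat].
  + by move=> x i; have [] := D x i.
  + move=> i; rewrite (_ : partial_deriv i _ =
      (fun x => ((flat k.+2 \o f) x + (cst (- k%:R) x * (flat k.+1 \o f) x)) *
        partial_deriv i f x)).
      apply: flat_closure_mul => //; apply: flat_closure_add; first exact: flat_closure_flat.
      by apply: flat_closure_mul; [exact: flat_closure_cst|exact: flat_closure_flat].
    apply/funext => x; rewrite /partial_deriv; have [_ ->] := D x i.
    by rewrite /= mulNr.
Qed.

Lemma flat_closure_is_smooth f : flat_closure f -> smooth f.
Proof. by apply: (smooth_coind (P := flat_closure)) => {}f; exact: flat_closure_step. Qed.

End smooth.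

(** * Test functions and cut-off *)

Section compact_support.
Context {R : realType} {n : nat}.
Implicit Types (f g phi eta : 'rV[R]_n -> R) (K U G S : set 'rV[R]_n).

Lemma compact_norm_le (V : normedModType R) (K : set V) :
  compact K -> exists2 M : R, 0 < M & forall x, K x -> `|x| <= M.
Proof.
move=> /compact_bounded[M [_ H]]; exists (Num.max 1 (M + 1)).
  by rewrite lt_max ltr01.
by move=> x Kx; apply: H => //; rewrite lt_max ltrDl ltr01 orbT.
Qed.

(** The closure of the [e/4]-neighbourhood of [S] is closed and bounded, and lies
    in the [e/2]-neighbourhood, which a covering argument puts inside [G]. *)
Lemma compact_nbhs_between S G : compact S -> open G -> S `<=` G ->
  exists F, [/\ compact F, S `<=` F° & F `<=` G].
Proof.
move=> cS oG SG.
have /compact_near_coveringP/(_ R 0^'+ (fun d x => ball x d `<=` G) _) := cS.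
case.
  move=> x /SG Gx.
  have /nbhs_ballP[r /= r0 xr] : nbhs x G by apply: open_nbhs_nbhs.
  exists (ball x (r / 2), [set d | 0 < d < r / 2]).
    split=> /=; first by apply: nbhsx_ballx; rewrite divr_gt0.
    near=> d; apply/andP; split; near: d; [exact: nbhs_right_gt|].
    by apply: nbhs_right_lt; rewrite divr_gt0.
  move=> [x' d] /= [xx' /andP[d0 dr]] y x'y; apply: xr.
  rewrite -(subrK (r / 2) r) (_ : r - r / 2 = r / 2); last by field.
  by apply: ball_triangle xx' _; apply: le_ball x'y; exact: ltW.
move=> e /= e0 H.
have {}H : S `<=` (fun x => ball x (e / 2) `<=` G).
  apply: (H (e / 2)) => //=; last by rewrite divr_gt0.
  by rewrite sub0r normrN ger0_norm ?ltr_pdivrMr ?mulr_ge0 ?invr_ge0 ?ltW// ltr_pMr ?ltr1n.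
have e4 : 0 < e / 4 by rewrite divr_gt0.
pose V := \bigcup_(x in S) ball x (e / 4).
have near_S y : closure V y -> exists2 x, S x & ball x (e / 2) y.
  move=> /(_ (ball y (e / 4)))[|z [[x Sx xz] yz]]; first exact: nbhsx_ballx.
  exists x => //; rewrite (_ : e / 2 = e / 4 + e / 4); last by field.
  by apply: ball_triangle xz _; exact: ball_sym.
exists (closure V); split.
- apply: bounded_closed_compact; last exact: closed_closure.
  have [M M0 SM] := compact_norm_le cS.
  exists (M + e / 2); split; first exact: num_real.
  move=> t tM y /near_S[x Sx]; rewrite -ball_normE /= => xy.
  rewrite -(subrK x y) (le_trans (ler_normD _ _))// addrC ltW//.
  by apply: le_lt_trans tM; apply: lerD; [exact: SM|rewrite distrC ltW].
- move=> x Sx; apply: (@filterS _ _ _ (ball x (e / 4))); last exact: nbhsx_ballx.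
  by move=> y xy; apply: subset_closure; exists x.
- by move=> y /near_S[x Sx]; exact: H.
Unshelve. all: by end_near. Qed.

Lemma fsupportS f x : f x != 0 -> fsupport f x.
Proof. by move=> fx; apply: subset_closure. Qed.

Lemma notin_fsupport f x : ~ fsupport f x -> f x = 0.
Proof. by move=> Nfx; apply/eqP; apply: contra_notT Nfx; exact: fsupportS. Qed.

Lemma compact_support_bounded f : continuous f -> compact (fsupport f) ->
  exists2 M : R, 0 < M & forall x, `|f x| <= M.
Proof.
move=> cf cK.
have /compact_norm_le[M M0 H] : compact (f @` fsupport f).
  by apply: continuous_compact => //; exact: continuous_subspaceT.
exists M => // x; have [fx|/notin_fsupport ->] := pselect (fsupport f x).
  by apply: H; exists x.
by rewrite normr0 ltW.
Qed.

Lemma fsupport_partial f i : fsupport (partial_deriv i f) `<=` fsupport f.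
Proof.
rewrite [X in X `<=` _]closureE; apply: smallest_sub; first exact: closed_closure.
move=> x /=; apply: contra_neqP => Nfx.
rewrite /partial_deriv -(@derive_cst _ _ _ 0 x (delta_mx ord0 i)).
apply: near_eq_derive.
have : nbhs x (~` fsupport f).
  apply: open_nbhs_nbhs; split => //; apply: closed_openC; exact: closed_closure.
by apply: filterS => y /notin_fsupport.
Qed.

Lemma test_fun_bounded U phi : test_fun U phi ->
  exists2 M : R, 0 < M & forall x, `|phi x| <= M.
Proof.
by move=> [/smooth_continuous cphi cK _]; exact: compact_support_bounded.
Qed.

(** The partial derivatives are continuous and vanish off the support, hence are
    bounded. *)
Lemma test_fun_lipschitz U phi : test_fun U phi ->
  exists2 L : R, 0 < L & forall x y, `|phi x - phi y| <= L * `|x - y|.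
Proof.
move=> [sphi cK _].
have H i : exists2 M : R, 0 < M & forall x, `|partial_deriv i phi x| <= M.
  apply: compact_support_bounded; first exact/smooth_continuous/smooth_partial.
  by apply: subclosed_compact cK (@fsupport_partial phi i); exact: closed_closure.
pose M i := sval (cid2 (H i)).
pose L := 1 + \sum_i M i.
have M0 i : 0 < M i by rewrite /M; case: cid2.
have L0 : 0 < L by rewrite /L ltr_pwDl// sumr_ge0// => i _; exact: ltW.
exists (n.+1%:R * L); first by rewrite mulr_gt0.
move=> x y; apply: le_trans (@partial_lipschitz _ _ phi L _ _ x y) _.
- exact: smooth_derivable.
- move=> i z; apply: (@le_trans _ _ (M i)); first by rewrite /M; case: cid2.
  rewrite /L (bigD1 i)//= addrCA lerDl addr_ge0// sumr_ge0// => j _.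
  exact: ltW.
- by rewrite mulrA ler_wpM2r// ler_pM2r// ler_nat.
Qed.

(** Composition of [eta] with [t |-> e * exp (- 1 / (1 - t))], extended by [0] for
    [t >= 1].  The factor [e] gives the value [1] where [eta] vanishes; the cut-off
    is [0] where [eta >= 1], and lies between [0] and [e] however large [eta] is. *)
Definition cutoff eta (x : 'rV[R]_n) : R := expR 1 * flat 0 (1 - eta x).

Lemma cutoff_eq0 eta x : 1 <= eta x -> cutoff eta x = 0.
Proof. by move=> e1; rewrite /cutoff flat_le0 ?mulr0// subr_le0. Qed.

Lemma cutoff_le eta x : `|1 - cutoff eta x| <= 2 * expR 1 * `|eta x|.
Proof.
have -> : 1 - cutoff eta x = expR 1 * (flat 0 1 - flat 0 (1 - eta x)).
  rewrite mulrBr (flat_gt0 _ ltr01) expr0 mul1r invr1.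
  by rewrite -[X in _ = X - _]expRD subrr expR0.
rewrite normrM (ger0_norm (expR_ge0 _)) [2 * _]mulrC -mulrA ler_wpM2l ?expR_ge0//.
apply: le_trans (flat_lipschitz _ _) _.
by rewrite opprB addrC subrK.
Qed.

Lemma cutoff_bounded eta x : `|1 - cutoff eta x| <= 1 + expR 1.
Proof.
apply: le_trans (ler_normB _ _) _; rewrite normr1 lerD2l.
rewrite ger0_norm ?mulr_ge0 ?expR_ge0 ?flat_ge0// ler_piMr ?expR_ge0//.
by apply: le_trans (flat_bounded _ _) _.
Qed.

Lemma cutoff_lipschitz eta x y :
  `|cutoff eta x - cutoff eta y| <= 2 * expR 1 * `|eta x - eta y|.
Proof.
rewrite -mulrBr normrM (ger0_norm (expR_ge0 _)).
rewrite [2 * _]mulrC -mulrA ler_wpM2l ?expR_ge0//.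
apply: le_trans (flat_lipschitz _ _) _.
have -> : 1 - eta x - (1 - eta y) = - (eta x - eta y) by ring.
by rewrite normrN.
Qed.

Lemma cutoff_smooth eta : smooth eta -> flat_closure (cutoff eta).
Proof.
move=> seta; apply: flat_closure_mul; first exact: flat_closure_cst.
apply: (@flat_closure_flat _ _ _ (fun x => 1 - eta x)).
apply: flat_closure_add; first exact: flat_closure_cst.
rewrite (_ : (fun _ => _) = (fun x => cst (-1) x * eta x)).
  by apply: flat_closure_mul; [exact: flat_closure_cst|exact: flat_closure_smooth].
by apply/funext => x; rewrite /= mulN1r.
Qed.

(** The support of the product avoids the interior of [F], where the cut-off
    vanishes, and this interior covers the part of [E] in the support of [phi]. *)
Lemma test_fun_cutoff U E F phi eta : test_fun U phi -> smooth eta ->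
  E `&` fsupport phi `<=` F° -> (forall x, F x -> 1 <= eta x) ->
  test_fun (U `\` E) (fun x => phi x * cutoff eta x).
Proof.
move=> [sphi cphi phiU] seta EF F1.
have sub : fsupport (fun x => phi x * cutoff eta x) `<=` fsupport phi `&` ~` F°.
  rewrite [X in X `<=` _]closureE; apply: smallest_sub.
    by apply: closedI; [exact: closed_closure|apply: open_closedC; exact: open_interior].
  move=> x /=; rewrite mulf_eq0 negb_or => /andP[px cx]; split.
    exact: fsupportS.
  by move=> /interior_subset /F1 /cutoff_eq0 /eqP; exact/negP.
split.
- apply: flat_closure_is_smooth; apply: flat_closure_mul.
    exact: flat_closure_smooth.
  exact: cutoff_smooth.
- by apply: subclosed_compact cphi _; [exact: closed_closure|move=> x /sub[]].
- by move=> x /sub[px Fx]; split; [exact: phiU|move=> Ex; apply: Fx; exact: EF].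
Qed.

End compact_support.

(** * Integrals and functions measurable for a completed measure *)

Section ae.
Import HBNNSimple.
Context d (T : measurableType d) (R : realType) (mu : {measure set T -> \bar R}).
Implicit Types (P : set T).

Lemma ae_forall_countable (I : countType) (P : I -> T -> Prop) :
  (forall i, \forall x \ae mu, P i x) -> \forall x \ae mu, forall i, P i x.
Proof.
move=> H.
have /ae_foralln : forall k, \forall x \ae mu, forall i, unpickle k = Some i -> P i x.
  move=> k; case: (unpickle k) => [i|]; last exact: aeW.
  by apply: filterS (H i) => x Pi j [<-].
by apply: filterS => x Hx i; apply: (Hx (pickle i)); rewrite pickleK.
Qed.

Lemma ae_measurable_superset P : (\forall x \ae mu, P x) ->
  exists N, [/\ measurable N, mu N = 0%E & forall x, ~ N x -> P x].
Proof.
move=> [N [mN N0 PN]]; exists N; split => // x; apply: contra_notP.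
exact: PN.
Qed.

(** Integrals of nonnegative functions are suprema over simple functions, and a
    simple function may be set to [0] on a null set without changing its
    integral; this covers functions measurable for the completed measure only. *)
Lemma integral_ae_congr (f g : T -> \bar R) :
  (\forall x \ae mu, f x = g x) -> (\int[mu]_x f x = \int[mu]_x g x)%E.
Proof.
have le f1 f2 : (\forall x \ae mu, f1 x = f2 x) ->
    (forall x, 0 <= f1 x)%E -> (forall x, 0 <= f2 x)%E ->
    (\int[mu]_x f1 x <= \int[mu]_x f2 x)%E.
  move=> /ae_measurable_superset[N [mN N0 EN]] f10 f20.
  rewrite (ge0_integralTE _ f10) (ge0_integralTE _ f20).
  apply: ge_ereal_sup => _ [h /= hf <-].
  have mC := measurableC mN.
  rewrite (_ : sintegral mu h = sintegral mu (proj_nnsfun h mC)).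
    apply: ereal_sup_ubound; exists (proj_nnsfun h mC) => //= x.
    rewrite mindicE; have [|_] := boolP (x \in ~` N); last by rewrite mulr0.
    by rewrite inE => /EN <-; rewrite mulr1.
  rewrite -!integralT_nnsfun; apply: ae_eq_integral => //.
  - exact/measurable_EFinP.
  - exact/measurable_EFinP.
  - exists N; split => // x /= H; apply: contrapT => Nx; apply: H => _.
    by rewrite mindicE mem_set// mulr1.
have eq f1 f2 : (\forall x \ae mu, f1 x = f2 x) ->
    (forall x, 0 <= f1 x)%E -> (forall x, 0 <= f2 x)%E ->
    (\int[mu]_x f1 x = \int[mu]_x f2 x)%E.
  move=> f12 f10 f20; apply/eqP; rewrite eq_le !le//.
  by apply: filterS f12.
move=> fg; rewrite integralE [RHS]integralE; congr (_ - _)%E; apply: eq => //.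
- by apply: filterS fg => x E; rewrite !funeposE E.
- by apply: filterS fg => x E; rewrite !funenegE E.
Qed.

Lemma integral_ae_congr_in (D : set T) (f g : T -> \bar R) :
  (\forall x \ae mu, D x -> f x = g x) ->
  (\int[mu]_(x in D) f x = \int[mu]_(x in D) g x)%E.
Proof.
move=> fg; rewrite integral_mkcond [RHS]integral_mkcond; apply: integral_ae_congr.
by apply: filterS fg => x H; rewrite /patch; case: ifPn => //; rewrite inE => /H.
Qed.

(** For every rational [q] a measurable [A q] differs from [{f > q}] by a null set;
    [g x] is the supremum of the [q] with [x] in [A q]. *)
Lemma completed_measurable_fun_ae (D : set T) (f : T -> R) :
  completed_measurable_fun mu D f ->
  exists2 g : T -> R, measurable_fun setT g & \forall x \ae mu, D x -> f x = g x.
Proof.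
move=> mf.
have H (q : rat) : exists A, [/\ measurable A, A `<=` D `&` f @^-1` `]ratr q, +oo[%classic &
    \forall x \ae mu, D x -> ratr q < f x -> A x].
  have [A mA [N negN E]] := mf `]ratr q, +oo[%classic (measurable_itv _).
  exists A; split => //; first by rewrite -E; exact: subsetUl.
  apply: negligibleS negN => x /= NAx; apply: contrapT => Nx; apply: NAx => Dx fx.
  have : (A `|` N) x by rewrite E; split => //=; rewrite in_itv/= fx.
  by case.
pose A q := sval (cid (H q)).
have mA q : measurable (A q) by rewrite /A; case: cid => ? [].
have AD q : A q `<=` D `&` f @^-1` `]ratr q, +oo[%classic by rewrite /A; case: cid => ? [].
have aeA : \forall x \ae mu, forall q, D x -> ratr q < f x -> A q x.
  by apply: ae_forall_countable => q; rewrite /A; case: cid => ? [].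
pose G x := ereal_sup [set (ratr q : R)%:E | q in [set q | A q x]].
have mG : measurable_fun setT G.
  apply: (measurability _ (ErealGenOInfty.measurableE R)) => _ [_ [r ->] <-].
  rewrite setTI (_ : _ @^-1` _ = \bigcup_q (if r < ratr q then A q else set0)).
    by apply: bigcupT_measurable_rat => q; case: ifP.
  apply/seteqP; split => x /=.
  - rewrite in_itv/= andbT => /ereal_sup_gt[_ [q Aq <-]].
    by rewrite lte_fin => rq; exists q => //; rewrite rq.
  - move=> [q _]; case: ifP => // rq Aq; rewrite in_itv/= andbT.
    by apply: (@lt_le_trans _ _ (ratr q)%:E);
      [rewrite lte_fin|apply: ereal_sup_ubound; exists q].
exists (fine \o G).
  by apply: measurableT_comp mG; exact: fine_measurable.
apply: filterS aeA => x Hx Dx.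
suff -> : (fine \o G) x = fine (f x)%:E by [].
congr fine; apply/eqP; rewrite eq_le; apply/andP; split.
  apply: ge_ereal_sup => _ [q /AD[_ /=]] + <-.
  by rewrite in_itv/= andbT lee_fin => /ltW.
apply/lee_subgt0Pr => e e0.
have /rat_in_itvoo[q] : f x - e < f x by rewrite ltrBlDr ltrDl.
rewrite in_itv/= => /andP[eq qf].
apply: (@le_trans _ _ (ratr q)%:E); first by rewrite -EFinB lee_fin ltW.
by apply: ereal_sup_ubound; exists q => //; exact: Hx.
Qed.

(** Approximate [w] by [floor (m * w) / m].  The values of the approximations are
    countably many, so only countably many sections [F ^~ t] have to be replaced
    by measurable functions, and continuity in [t] recovers the limit. *)
Lemma caratheodory_comp_ae (F : T -> R -> R) (w : T -> R) :
  (forall t, completed_measurable_fun mu setT (F ^~ t)) ->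
  (\forall p \ae mu, continuous (F p)) -> measurable_fun setT w ->
  exists2 g : T -> R, measurable_fun setT g & \forall p \ae mu, F p (w p) = g p.
Proof.
move=> mF cF mw.
pose t (mk : nat * int) : R := mk.2%:~R / mk.1.+1%:R.
pose a mk := s2val (cid2 (completed_measurable_fun_ae (mF (t mk)))).
have ma mk : measurable_fun setT (a mk) by rewrite /a; case: cid2.
have aea : \forall p \ae mu, forall mk, F p (t mk) = a mk p.
  apply: ae_forall_countable => mk; rewrite /a; case: cid2 => g /= _.
  by apply: filterS => p; exact.
pose k m p : int := Num.floor (w p * m.+1%:R).
pose W m p := a (m, k m p) p.
have mW m : measurable_fun setT (W m).
  move=> _ Y mY; rewrite setTI.
  rewrite (_ : W m @^-1` Y = \bigcup_(j : int)
    (((fun p => Num.floor (w p * m.+1%:R)) @^-1` [set j]) `&` a (m, j) @^-1` Y)).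
    apply: countable_bigcupT_measurable => // j; apply: measurableI.
    - rewrite (_ : _ @^-1` _ = (fun p => w p * m.+1%:R) @^-1` `[j%:~R, (j + 1)%:~R[%classic).
        rewrite -[X in measurable X]setTI; apply: measurable_funM => //.
      apply/seteqP; split => p /=; rewrite in_itv/=.
        by move=> <-; exact: floor_itv.
      by move=> H; exact: floor_def.
    - by rewrite -[X in measurable X]setTI; exact: ma.
  apply/seteqP; split => p /=; first by move=> Yp; exists (k m p).
  by move=> [j _ [kj Yp]]; rewrite /W /k kj.
exists (fun p => fine (limn_esup (fun m => (W m p)%:E))).
  apply: measurableT_comp; first exact: fine_measurable.
  by apply: measurable_fun_limn_esup => m; exact/measurable_EFinP.
near=> p.
have cp : continuous (F p) by near: p.
have ap mk : F p (t mk) = a mk p by move: mk; near: p.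
have C : (fun m => W m p) @ \oo --> F p (w p).
  rewrite (_ : (fun m => _) = F p \o (fun m => t (m, k m p))); last first.
    by apply/funext => m; rewrite /= ap.
  apply: continuous_cvg; first exact: cp.
  apply: (@squeeze_cvgr _ _ _ _ (fun m => w p - harmonic m) (cst (w p))).
  - apply: nearW => m; rewrite /t /k /harmonic /=.
    have /andP[f1 f2] := floor_itv (w p * m.+1%:R).
    rewrite ler_pdivrMr// f1 andbT ler_pdivlMr// mulrBl mulVf//.
    by rewrite lerBlDr ltW// -intrD1.
  - rewrite -[X in _ --> X]subr0; apply: cvgB; first exact: cvg_cst.
    exact: cvg_harmonic.
  - exact: cvg_cst.
have : (W m p)%:E @[m --> \oo] --> (F p (w p))%:E.
  by apply: cvg_EFin; [exact: nearW|exact: C].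
by move=> /cvg_limn_einf_sup[_ ->].
Unshelve. all: by end_near. Qed.

End ae.

(** * Almost everywhere in a product *)

Section product.
Context d1 d2 (T1 : measurableType d1) (T2 : measurableType d2) (R : realType).
Variables (m1 : {sigma_finite_measure set T1 -> \bar R})
  (m2 : {sigma_finite_measure set T2 -> \bar R}).

(** The measure of a null set is the integral of the measures of its sections. *)
Lemma ae_prod_section (P : set (T1 * T2)) :
  (\forall p \ae (m1 \x m2)%E, P p) -> \forall x \ae m1, \forall y \ae m2, P (x, y).
Proof.
move=> [N [mN N0 PN]].
have mx := measurable_fun_xsection m2 mN.
have /(ae_eq_integral_abs _ measurableT mx) : (\int[m1]_x `|(m2 \o xsection N) x|)%E = 0%E.
  by rewrite -[RHS]N0; apply: eq_integral => x _; rewrite gee0_abs.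
apply: filterS => x /(_ I) /= N0x.
exists (xsection N x); split => //; first exact: measurable_xsection.
by move=> y /= /PN Nxy; rewrite /xsection/= inE.
Qed.

Lemma ae_prod_fst (P : set T1) :
  (\forall x \ae m1, P x) -> \forall p \ae (m1 \x m2)%E, P p.1.
Proof.
move=> [N [mN N0 PN]]; exists (N `*` setT); split.
- exact: measurableX.
- by rewrite product_measure1E// [X in (X * _)%E]N0 mul0e.
- by move=> p /= /PN.
Qed.

Lemma ae_prod_snd (P : set T2) :
  (\forall x \ae m2, P x) -> \forall p \ae (m1 \x m2)%E, P p.2.
Proof.
move=> [N [mN N0 PN]]; exists (setT `*` N); split.
- exact: measurableX.
- by rewrite product_measure1E// [X in (_ * X)%E]N0 mule0.
- by move=> p /= /PN.
Qed.

Lemma iterated_integral_ae_congr (f g : T1 * T2 -> \bar R) :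
  (\forall p \ae (m1 \x m2)%E, f p = g p) ->
  (\int[m1]_x \int[m2]_y f (x, y) = \int[m1]_x \int[m2]_y g (x, y))%E.
Proof.
move=> /ae_prod_section fg; apply: integral_ae_congr.
by apply: filterS fg => x; exact: integral_ae_congr.
Qed.

End product.

(** * Borel sets and Lebesgue measure of cubes in R^n *)

Section borel.
Context {R : realType} {n : nat}.
Implicit Types (U : set 'rV[R]_n).

(** The balls of the sup norm, in the coordinatewise form that suits an iterated
    product measure. *)
Definition cube (c : 'rV[R]_n) (r : R) : set 'rV[R]_n :=
  [set y | forall i, `|y ord0 i - c ord0 i| < r].

Lemma measurable_cube c r : measurable (cube c r).
Proof.
rewrite (_ : cube c r = \bigcap_(i in [set: 'I_n]) [set y | `|y ord0 i - c ord0 i| < r]).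
  apply: fin_bigcap_measurable => // i _.
  have mi : measurable_fun setT (fun y : 'rV[R]_n => `|y ord0 i - c ord0 i|).
    apply: measurableT_comp => //; apply: measurable_funB => //.
    exact: measurable_coor.
  have := mi measurableT _ (measurable_itv `]-oo, r[); rewrite setTI.
  by congr measurable; apply/seteqP; split => y /=; rewrite in_itv.
by apply/seteqP; split => y /= H i; [move=> _|]; exact: H.
Qed.

Lemma cubeE c r y : 0 < r -> cube c r y <-> `|y - c| < r.
Proof.
move=> r0; rewrite [ltLHS]mx_normrE.
split=> [H|H i].
- apply: bigmax_lt => // -[i j] _ /=; rewrite (ord1 i) !mxE; exact: H.
- apply: le_lt_trans H; rewrite -[_ - _](_ : (y - c) ord0 i = _); last by rewrite !mxE.
  by apply: (le_trans _ (le_bigmax _ _ (ord0, i))).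
Qed.

(** An open set is the union of the cubes with rational centre and radius [1/(m+1)]
    that it contains. *)
Lemma open_measurable_rV U : open U -> measurable U.
Proof.
move=> oU.
pose q2r (q : 'rV[rat]_n) : 'rV[R]_n := map_mx ratr q.
pose Q (p : 'rV[rat]_n * nat) := cube (q2r p.1) p.2.+1%:R^-1.
rewrite (_ : U = \bigcup_p (if `[< Q p `<=` U >] then Q p else set0)).
  apply: countable_bigcupT_measurable => // p; case: ifP => // _.
  exact: measurable_cube.
apply/seteqP; split => x; last by move=> [p _]; case: asboolP => // H /H.
move=> Ux.
have /nbhs_ballP[r /= r0 xr] : nbhs x U by apply: open_nbhs_nbhs.
have [m _ /(_ m (leqnn m)) mr] : \forall m \near \oo, (harmonic m : R) < r / 2.
  by apply: cvgr_lt; [exact: cvg_harmonic|rewrite divr_gt0].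
have H i : exists q : rat, `|x ord0 i - ratr q| < m.+1%:R^-1.
  have /rat_in_itvoo[q] : x ord0 i < x ord0 i + m.+1%:R^-1 by rewrite ltrDl.
  rewrite in_itv/= => /andP[q1 q2]; exists q.
  by rewrite distrC ger0_norm ?subr_ge0 ?ltW// ltrBlDl.
pose q : 'rV[rat]_n := \row_i sval (cid (H i)).
have Qx : Q (q, m) x.
  by move=> i; rewrite !mxE; case: cid.
exists (q, m) => //; case: asboolP => // nQ; exfalso; apply: nQ => y Qy.
apply: xr; rewrite -ball_normE /=.
have m0 : 0 < m.+1%:R^-1 :> R by [].
move: Qx Qy; rewrite /Q !cubeE//= => Qx Qy.
rewrite -(subrKA (q2r q)); apply: le_lt_trans (ler_normD _ _) _.
rewrite (distrC (q2r q)) [ltRHS](_ : _ = r / 2 + r / 2); last by field.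
by apply: ltrD; [apply: lt_trans Qx mr|apply: lt_trans Qy mr].
Qed.

Lemma continuous_measurable_rV (f : 'rV[R]_n -> R) :
  continuous f -> measurable_fun setT f.
Proof.
move=> /continuousP cf; apply: (measurability _ (RGenOInfty.measurableE R)).
move=> _ [_ [r ->] <-]; rewrite setTI; apply: open_measurable_rV.
by apply: cf; exact: interval_open.
Qed.

End borel.

Lemma lebesgue_rV_cube (R : realType) n (c : 'rV[R]_n) (r : R) : 0 < r ->
  lebesgue_rV R n (cube c r) = ((2 * r) ^+ n)%:E.
Proof.
move=> r0; elim: n c => [|n IH] c.
  by rewrite /= diracE mem_set ?expr0// => -[].
rewrite /= /lebesgue_rV_step /pushforward.
rewrite (_ : _ @^-1` _ = `]c ord0 ord0 - r, c ord0 ord0 + r[%classic `*`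
   cube (\row_j c ord0 (lift ord0 j)) r).
  rewrite product_measure1E//; last exact: measurable_cube.
  rewrite IH; rewrite [X in (X * _)%E]lebesgue_measure_itv/= lte_fin.
  rewrite ltrD2l gtrN// -EFinB -EFinM exprS; congr (_ * _)%:E.
  by ring.
apply/seteqP; split => -[a v] /=; have := rV_consK (a, v);
  rewrite /rV_uncons => -[E1 E2].
- move=> H; split.
    by have := H ord0; rewrite E1 in_itv /= -ltr_distl.
  move=> i; rewrite [X in _ - X]mxE.
  by have := H (lift ord0 i); rewrite -[in X in _ -> X]E2 [(\row__ _) _ _]mxE.
- rewrite in_itv /= -ltr_distl => -[a1 H] i.
  have [j ->|->] := unliftP ord0 i; last by rewrite E1.
  by have := H j; rewrite -[in X in X -> _]E2 [X in `|X - _|]mxE [X in `|_ - X|]mxE.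
Qed.

(** * The kernel *)

Section kernel.
Context {R : realType} {n : nat}.
Implicit Types (x y z : 'rV[R]_n) (s : R).
Local Notation leb := (lebesgue_rV R n).

Lemma norm_le_enorm x : `|x| <= enorm x.
Proof.
rewrite [leLHS]mx_normrE; apply: bigmax_le => [|[i j] _ /=]; first exact: sqrtr_ge0.
rewrite (ord1 i) -sqrtr_sqr ler_wsqrtr// (bigD1 j)//= lerDl.
by apply: sumr_ge0 => k _; exact: sqr_ge0.
Qed.

Lemma enorm_le_norm x : enorm x <= n%:R * `|x|.
Proof.
have H i : x ord0 i ^+ 2 <= `|x| ^+ 2.
  rewrite -[x ord0 i ^+ 2]real_normK ?num_real// lerXn2r ?nnegrE//.
  by rewrite [leRHS]mx_normrE; apply: (le_trans _ (le_bigmax _ _ (ord0, i))).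
rewrite -[leRHS]ger0_norm ?mulr_ge0// -sqrtr_sqr ler_wsqrtr//.
apply: le_trans (ler_sum _ (fun i _ => H i)) _.
rewrite sumr_const card_ord -[leLHS]mulr_natl exprMn ler_wpM2r ?sqr_ge0//.
by rewrite -natrX ler_nat; case: n => // m; rewrite leq_pmulr.
Qed.

Lemma enormN x : enorm (- x) = enorm x.
Proof. by congr Num.sqrt; apply: eq_bigr => i _; rewrite mxE sqrrN. Qed.

Lemma frac_kernel_ge0 s x y : 0 <= frac_kernel s x y.
Proof. by rewrite invr_ge0 powR_ge0. Qed.

Lemma frac_kernelC s x y : frac_kernel s x y = frac_kernel s y x.
Proof. by rewrite /frac_kernel -opprB enormN. Qed.

Lemma measurable_enormB : measurable_fun setT
  (fun p : 'rV[R]_n * 'rV[R]_n => enorm (p.1 - p.2)).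
Proof.
rewrite (_ : (fun _ => _) = (fun p : 'rV[R]_n * 'rV[R]_n =>
    (\sum_i (p.1 ord0 i - p.2 ord0 i) ^+ 2) `^ 2^-1)).
  apply: (measurableT_comp (measurable_powR _)).
  apply: measurable_sum => i; apply: measurable_funX; apply: measurable_funB.
  - exact: (measurableT_comp (@measurable_coor R n i) measurable_fst).
  - exact: (measurableT_comp (@measurable_coor R n i) measurable_snd).
apply/funext => p; rewrite powR12_sqrt; last by apply: sumr_ge0 => i _; exact: sqr_ge0.
by congr Num.sqrt; apply: eq_bigr => i _; rewrite !mxE.
Qed.

Lemma measurable_frac_kernel s : measurable_fun setT
  (fun p : 'rV[R]_n * 'rV[R]_n => frac_kernel s p.1 p.2).
Proof.
rewrite (_ : (fun _ => _) = (fun p => enorm (p.1 - p.2) `^ (- (n%:R + s)))).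
  exact: (measurableT_comp (measurable_powR _) measurable_enormB).
by apply/funext => p; rewrite powRN.
Qed.

(** The power is split into an integer and a fractional part so that the dyadic
    estimates below only involve integer powers. *)
Lemma frac_kernel_le s x y d : 0 < s -> 0 < d -> d <= `|x - y| ->
  frac_kernel s x y <= (d ^+ n * d `^ s)^-1.
Proof.
move=> s0 d0 dxy.
have d1 : d <= enorm (x - y) by apply: le_trans dxy _; exact: norm_le_enorm.
have -> : d ^+ n * d `^ s = d `^ (n%:R + s).
  by rewrite powRD ?(gt_eqF d0) ?implybT// powR_mulrn// ltW.
have e0 : 0 < enorm (x - y) by apply: lt_le_trans d1.
rewrite /frac_kernel lef_pV2 ?posrE ?powR_gt0//.
apply: ge0_ler_powR => //; rewrite ?nnegrE ?(ltW d0) ?(ltW e0)//.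
by rewrite addr_ge0// ltW.
Qed.

Lemma frac_kernel_ge s x y d : 0 < s -> 0 <= d -> 0 < `|x - y| <= d ->
  ((n%:R * d) `^ (n%:R + s))^-1 <= frac_kernel s x y.
Proof.
move=> s0 d0 /andP[xy0 xyd].
have e0 : 0 < enorm (x - y) by apply: lt_le_trans xy0 _; exact: norm_le_enorm.
have ed : enorm (x - y) <= n%:R * d.
  by apply: le_trans (enorm_le_norm _) _; rewrite ler_wpM2l.
rewrite /frac_kernel lef_pV2 ?posrE ?powR_gt0//; last exact: lt_le_trans ed.
apply: ge0_ler_powR => //; rewrite ?nnegrE ?mulr_ge0 ?(ltW e0)//.
by rewrite addr_ge0// ltW.
Qed.

Lemma sum_geometric_le (q : R) m : 0 <= q < 1 -> \sum_(0 <= k < m) q ^+ k <= (1 - q)^-1.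
Proof.
move=> /andP[q0 q1]; have q1' : 0 < 1 - q by rewrite subr_gt0.
suff -> : \sum_(0 <= k < m) q ^+ k = (1 - q ^+ m) / (1 - q).
  by rewrite ler_pdivrMr// mulVf ?gt_eqF// gerBl exprn_ge0.
elim: m => [|m IH]; first by rewrite big_nil expr0 subrr mul0r.
by rewrite big_nat_recr//= IH exprS; field; rewrite gt_eqF.
Qed.

Lemma dyadic_small (d : R) : 0 < d < 1 -> exists k, 2^-1 ^+ k.+1 <= d < 2^-1 ^+ k.
Proof.
move=> /andP[d0 d1].
have ex : exists k, 2^-1 ^+ k <= d.
  have : \forall m \near \oo, (2^-1 : R) ^+ m < d.
    apply: cvgr_lt d0; apply: cvg_expr.
    by rewrite ger0_norm ?invr_ge0// invf_lt1 ?ltr1n.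
  by move=> [m _ /(_ m (leqnn m)) /ltW]; exists m.
case: (ex_minnP ex) => -[|k] kd kmin.
  by move: kd; rewrite expr0 leNgt d1.
exists k; rewrite kd /= ltNge; apply/negP => /kmin.
by rewrite ltnn.
Qed.

Lemma dyadic_large (d : R) : 1 <= d -> exists k, 2 ^+ k <= d < 2 ^+ k.+1.
Proof.
move=> d1.
have ex : exists k, d < 2 ^+ k.
  have d0 : 0 < d^-1 by rewrite invr_gt0 (lt_le_trans _ d1).
  have : \forall m \near \oo, (2^-1 : R) ^+ m < d^-1.
    apply: cvgr_lt d0; apply: cvg_expr.
    by rewrite ger0_norm ?invr_ge0// invf_lt1 ?ltr1n.
  move=> [m _ /(_ m (leqnn m))]; exists m.
  by rewrite -ltf_pV2 ?posrE ?exprn_gt0 ?(lt_le_trans _ d1)// -exprVn.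
case: (ex_minnP ex) => -[|k] kd kmin.
  by move: kd; rewrite expr0 ltNge d1.
exists k; rewrite kd andbT leNgt; apply/negP => /kmin.
by rewrite ltnn.
Qed.

End kernel.

(** * Integrals against the kernel *)

Section kernel_bounds.
Context {R : realType} {n : nat}.
Implicit Types (x y z : 'rV[R]_n) (s : R) (f g phi eta theta : 'rV[R]_n -> R).
Local Notation leb := (lebesgue_rV R n).

Lemma half_powR_itv s : 0 < s < 1 -> 2^-1 < (2^-1 : R) `^ s < 1.
Proof.
move=> /andP[s0 s1].
have l0 : ln (2^-1 : R) < 0 by rewrite ln_lt0// invr_gt0 ltr0n invf_lt1 ?ltr1n.
have p0 : 0 < (2^-1 : R) `^ s by rewrite powR_gt0.
rewrite -ltr_ln ?posrE// ln_powR -[X in X < _]mul1r ltr_nM2r// s1/=.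
by rewrite -ltr_ln ?posrE// ln1 ln_powR nmulr_llt0.
Qed.

Lemma powR_exprn (b s : R) k : 0 <= b -> (b ^+ k) `^ s = (b `^ s) ^+ k.
Proof. by move=> b0; rewrite -powR_mulrn// powRAC powR_mulrn// powR_ge0. Qed.

Lemma integral_scaled_cube (a r : R) x : 0 <= a -> 0 < r ->
  (\int[leb]_y (a * \1_(cube x r) y)%:E = (a * (2 * r) ^+ n)%:E)%E.
Proof.
move=> a0 r0; have mC := @measurable_cube R n x r; under eq_integral do rewrite EFinM.
rewrite ge0_integralZl_EFin//.
- by rewrite integral_indic ?setIT// [X in (_ * X)%E](lebesgue_rV_cube x r0) EFinM.
- exact/measurable_EFinP/measurable_indic.
Qed.

(** On the dyadic shell [|x - y| ~ 2^-k] use the Lipschitz bound, on the shell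
    [|x - y| ~ 2^k] the bound [M].  Each shell lies in a cube whose measure
    balances the factor [|x - y|^-n] of the kernel, and what remains are geometric
    series of ratio [2^-(1-s)] and [2^-s], respectively. *)
Lemma lipschitz_bounded_kernel_integral s f (L M : R) : 0 < s < 1 -> 0 <= L -> 0 <= M ->
  continuous f -> (forall x y, `|f x - f y| <= L * `|x - y|) ->
  (forall x y, `|f x - f y| <= M) ->
  exists2 C : R, 0 <= C &
    forall x, (\int[leb]_y (`|f x - f y| * frac_kernel s x y)%:E <= C%:E)%E.
Proof.
move=> s01 L0 M0 cf lf bf.
have s0 : 0 < s by case/andP: s01.
have /andP[t2 t1] := half_powR_itv s01; set t := 2^-1 `^ s in t2 t1.
have t0 : 0 < t by apply: lt_trans t2.
have tV : 2 `^ s = t^-1.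
  apply: (mulIf (lt0r_neq0 t0)); rewrite mulVf ?gt_eqF// -powRM//.
  by rewrite divff// powR1.
(* upper bounds of the integrand on the [k]-th small and large shells *)
pose a k := L * 2^-1 ^+ k * ((2^-1 ^+ k.+1) ^+ n * t ^+ k.+1)^-1.
pose b k := M * ((2 ^+ k) ^+ n * t^-1 ^+ k)^-1.
have a0 k : 0 <= a k by rewrite !mulr_ge0 ?invr_ge0 ?mulr_ge0 ?exprn_ge0 ?invr_ge0// ltW.
have b0 k : 0 <= b k by rewrite !mulr_ge0 ?invr_ge0 ?mulr_ge0 ?exprn_ge0 ?invr_ge0// ltW.
(* [t = 2^-s], so that [q = 2^-(1-s)] *)
pose q := 2^-1 / t.
have q01 : 0 <= q < 1 by rewrite divr_ge0 ?invr_ge0 ?ltW//= ltr_pdivrMr// mul1r.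
pose A : R := 2 ^+ n.
have A0 : 0 < A by rewrite exprn_gt0.
have aE k : a k * (2 * 2^-1 ^+ k) ^+ n = L * A ^+ 2 / t * q ^+ k.
  rewrite /a /q exprS [in LHS]exprS !exprMn !exprVn -/A.
  field.
  by rewrite !expf_neq0 ?gt_eqF// expf_neq0 ?gt_eqF// exprn_gt0.
have bE k : b k * (2 * 2 ^+ k.+1) ^+ n = M * A ^+ 2 * t ^+ k.
  rewrite /b exprS !exprMn !exprVn -/A.
  field.
  by rewrite !expf_neq0 ?gt_eqF// exprn_gt0.
pose C := L * A ^+ 2 / t * (1 - q)^-1 + M * A ^+ 2 * (1 - t)^-1.
exists C.
  have /andP[_ q1] := q01.
  by rewrite addr_ge0// !mulr_ge0 ?invr_ge0 ?subr_ge0 ?exprn_ge0// ltW.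
move=> x.
pose F k y := (a k * \1_(cube x (2^-1 ^+ k)) y + b k * \1_(cube x (2 ^+ k.+1)) y)%:E.
have F0 k y : (0 <= F k y)%E by rewrite lee_fin addr_ge0// mulr_ge0.
have mc (c r : R) : measurable_fun setT (fun y => (c * \1_(cube x r) y)%:E).
  apply/measurable_EFinP; apply: measurable_funM => //.
  by apply: measurable_indic; exact: measurable_cube.
have mF k : measurable_fun setT (F k).
  by rewrite /F; under eq_fun do rewrite EFinD; apply: emeasurable_funD; exact: mc.
have intF k : (\int[leb]_y F k y = (L * A ^+ 2 / t * q ^+ k + M * A ^+ 2 * t ^+ k)%:E)%E.
  rewrite /F; under eq_integral do rewrite EFinD.
  rewrite ge0_integralD//; first last.
  - by move=> y _; rewrite lee_fin mulr_ge0.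
  - by move=> y _; rewrite lee_fin mulr_ge0.
  - by rewrite !integral_scaled_cube ?exprn_gt0// aE bE -EFinD.
apply: (@le_trans _ _ (\int[leb]_y \sum_(0 <= k <oo) F k y)%E).
  apply: ge0_le_integral => //.
  - by move=> y _; rewrite lee_fin mulr_ge0 ?frac_kernel_ge0.
  - apply/measurable_EFinP; apply: measurable_funM.
      apply: measurableT_comp => //; apply: measurable_funB => //.
      exact: continuous_measurable_rV.
    exact: (measurableT_comp (measurable_frac_kernel s) (measurable_pair1 x)).
  - by apply: ge0_emeasurable_sum => // k y _ _.
  - move=> y _.
    have FS k : (F k y <= \sum_(0 <= k <oo) F k y)%E.
      apply: le_trans (nneseries_lim_ge k.+1 _) => //.
      by rewrite big_nat_recr//= leeDr// sume_ge0.
    have [xy|xy] := eqVneq x y.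
      by rewrite xy subrr normr0 mul0r; apply: nneseries_ge0.
    have d0 : 0 < `|x - y| by rewrite normr_gt0 subr_eq0.
    have [d1|d1] := ltP `|x - y| 1.
      have [|k /andP[k1 k2]] := @dyadic_small _ `|x - y|; first by rewrite d0.
      apply: le_trans (FS k); rewrite lee_fin.
      have -> : \1_(cube x (2^-1 ^+ k)) y = 1 :> R.
        by rewrite indicE mem_set//; apply/cubeE; rewrite ?exprn_gt0// distrC.
      rewrite mulr1 -[leLHS]addr0; apply: lerD; last exact: mulr_ge0 (b0 k) _.
      apply: ler_pM => //; first exact: frac_kernel_ge0.
        by apply: le_trans (lf _ _) _; rewrite ler_wpM2l// ltW.
      by apply: le_trans (frac_kernel_le s0 _ k1) _; rewrite ?exprn_gt0// powR_exprn.
    have [k /andP[k1 k2]] := dyadic_large d1.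
    apply: le_trans (FS k); rewrite lee_fin.
    have -> : \1_(cube x (2 ^+ k.+1)) y = 1 :> R.
      by rewrite indicE mem_set//; apply/cubeE; rewrite ?exprn_gt0// distrC.
    rewrite mulr1 -[leLHS]add0r; apply: lerD; first exact: mulr_ge0 (a0 k) _.
    apply: ler_pM => //; first exact: frac_kernel_ge0.
    by apply: le_trans (frac_kernel_le s0 _ k1) _; rewrite ?exprn_gt0// powR_exprn// tV.
rewrite integral_nneseries//.
apply: lime_le; first by apply: is_cvg_nneseries => k _ _; exact: integral_ge0.
apply: nearW => m; under eq_bigr do rewrite intF.
rewrite sumEFin lee_fin big_split/= -!mulr_sumr.
have A2 : 0 <= A ^+ 2 by exact: sqr_ge0.
apply: lerD; apply: ler_wpM2l; rewrite ?sum_geometric_le//.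
- by rewrite divr_ge0 ?mulr_ge0// ltW.
- by rewrite mulr_ge0.
- by rewrite ltW.
Qed.

End kernel_bounds.

(** * The Gagliardo seminorm *)

Section gagliardo.
Context {R : realType} {n : nat}.
Implicit Types (x y z : 'rV[R]_n) (s : R) (f g phi eta theta : 'rV[R]_n -> R).
Local Notation leb := (lebesgue_rV R n).

Lemma gagliardo_integrand_ge0 s f x y : (0 <= (`|f x - f y| * frac_kernel s x y)%:E)%E.
Proof. by rewrite lee_fin mulr_ge0 ?frac_kernel_ge0. Qed.

Lemma measurable_gagliardo_integrand s f : continuous f ->
  measurable_fun setT (fun p : 'rV[R]_n * 'rV[R]_n =>
    (`|f p.1 - f p.2| * frac_kernel s p.1 p.2)%:E).
Proof.
move=> /continuous_measurable_rV mf; apply/measurable_EFinP.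
apply: measurable_funM; last exact: measurable_frac_kernel.
apply: measurableT_comp => //; apply: measurable_funB.
- exact: (measurableT_comp mf measurable_fst).
- exact: (measurableT_comp mf measurable_snd).
Qed.

Lemma measurable_gagliardo_section s f x : continuous f ->
  measurable_fun setT (fun y => (`|f x - f y| * frac_kernel s x y)%:E).
Proof.
by move=> cf; exact: (measurableT_comp (measurable_gagliardo_integrand s cf) (measurable_pair1 x)).
Qed.

Lemma measurable_gagliardo_inner s f : continuous f ->
  measurable_fun setT (fun x => \int[leb]_y (`|f x - f y| * frac_kernel s x y)%:E)%E.
Proof.
move=> cf; apply: (measurable_fun_fubini_tonelli_F
  (fun p => (`|f p.1 - f p.2| * frac_kernel s p.1 p.2)%:E)).
  exact: measurable_gagliardo_integrand.
by move=> p; exact: gagliardo_integrand_ge0.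
Qed.

Lemma measurable_abs_EFin f : continuous f -> measurable_fun setT (fun x => `|f x|%:E).
Proof.
move=> /continuous_measurable_rV mf; apply/measurable_EFinP.
exact: measurableT_comp.
Qed.

(** For [x] in the cube of side [2r] about [0] and [y] in its translate by [2r] in
    every direction, [eta y = 0] and the kernel is bounded below: integrate
    [|eta x - eta y| = |eta x|] over these [y].  The dimension must be positive
    for the two cubes to be disjoint. *)
Lemma L1_le_gagliardo s r : (0 < n)%N -> 0 < s -> 0 < r -> exists2 c : R, 0 <= c &
  forall eta, continuous eta -> (forall x, ~ cube 0 r x -> eta x = 0) ->
    (\int[leb]_x `|eta x|%:E <= c%:E * gagliardo s eta)%E.
Proof.
move=> n0 s0 r0.
have i0 : 'I_n by case: n n0 => // m _; exact: ord0.
pose c0 : 'rV[R]_n := \row_i (2 * r).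
pose kap := ((n%:R * (4 * r)) `^ (n%:R + s))^-1 * (2 * r) ^+ n.
have kap0 : 0 < kap.
  by rewrite mulr_gt0 ?exprn_gt0 ?invr_gt0 ?powR_gt0 ?mulr_gt0// ltr0n.
exists kap^-1; first by rewrite invr_ge0 ltW.
move=> eta ceta eta0.
suff H : (kap%:E * \int[leb]_x `|eta x|%:E <= gagliardo s eta)%E.
  have : (kap^-1%:E * (kap%:E * \int[leb]_x `|eta x|%:E) <= kap^-1%:E * gagliardo s eta)%E.
    by apply: lee_wpmul2l => //; rewrite lee_fin invr_ge0 ltW.
  by rewrite muleA -EFinM mulVf ?gt_eqF// mul1e.
rewrite -ge0_integralZl_EFin//; last 2 first.
- exact: measurable_abs_EFin.
- exact: ltW.
apply: ge0_le_integral => //.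
- by move=> x _; rewrite -EFinM lee_fin mulr_ge0// ltW.
- by apply: measurable_funeM; exact: measurable_abs_EFin.
- exact: measurable_gagliardo_inner.
move=> x _.
have [cx|/eta0 ->] := pselect (cube 0 r x); last first.
  by rewrite normr0 mule0; apply: integral_ge0 => y _; rewrite lee_fin mulr_ge0 ?frac_kernel_ge0.
have mC := @measurable_cube R n c0 r.
apply: (@le_trans _ _ (\int[leb]_(y in cube c0 r)
   (`|eta x| * ((n%:R * (4 * r)) `^ (n%:R + s))^-1)%:E)%E).
  rewrite integral_cst// [X in (_ <= _ * X)%E](lebesgue_rV_cube c0 r0) -!EFinM lee_fin.
  by rewrite [leLHS]mulrC /kap [leLHS]mulrA.
apply: (@le_trans _ _ (\int[leb]_(y in cube c0 r)
   (`|eta x - eta y| * frac_kernel s x y)%:E)%E).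
  apply: ge0_le_integral => //.
  - by move=> y _; rewrite lee_fin mulr_ge0// invr_ge0 powR_ge0.
  - exact: measurable_funTS (measurable_gagliardo_section s x ceta).
  - move=> y cy; rewrite lee_fin.
    have cyi i : r < y ord0 i < 3 * r.
      have := cy i; rewrite mxE ltr_distl => /andP[H1 H2].
      by apply/andP; split; lra.
    have cxi i : - r < x ord0 i < r by have := cx i; rewrite mxE subr0 ltr_norml.
    rewrite (eta0 y); last first.
      move=> /(_ i0); rewrite mxE subr0 ltr_norml => /andP[_].
      by have /andP[+ _] := cyi i0; lra.
    rewrite subr0 ler_wpM2l//; apply: frac_kernel_ge => //.
      by rewrite mulr_ge0// ltW.
    apply/andP; split.
      rewrite normr_gt0; apply/eqP => /rowP/(_ i0); rewrite !mxE.
      by have /andP[+ _] := cyi i0; have /andP[_ +] := cxi i0; lra.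
    rewrite [leLHS]mx_normrE; apply: bigmax_le => [|[i j] _ /=].
      by rewrite mulr_ge0// ltW.
    rewrite (ord1 i) !mxE ler_norml; have /andP[? ?] := cyi j; have /andP[? ?] := cxi j.
    by apply/andP; split; lra.
apply: ge0_subset_integral => //.
- exact: (measurable_gagliardo_section s x ceta).
- by move=> y _; exact: gagliardo_integrand_ge0.
Qed.

(** Integrate
    [|(phi theta) x - (phi theta) y| <=
       |theta x| |phi x - phi y| + |phi y| |theta x - theta y|]. *)
Lemma gagliardo_product_le s phi theta eta (C M l : R) :
  continuous phi -> continuous theta -> continuous eta ->
  0 <= C -> 0 <= M -> 0 <= l ->
  (forall x, (\int[leb]_y (`|phi x - phi y| * frac_kernel s x y)%:E <= C%:E)%E) ->
  (forall x, `|phi x| <= M) -> (forall x, `|theta x| <= l * `|eta x|) ->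
  (forall x y, `|theta x - theta y| <= l * `|eta x - eta y|) ->
  (gagliardo s (fun x => phi x * theta x)%R <=
    (l * C)%:E * \int[leb]_x `|eta x|%:E + (M * l)%:E * gagliardo s eta)%E.
Proof.
move=> cphi cth ceta C0 M0 l0 HC HM Hth Hl.
have lC : 0 <= l * C by rewrite mulr_ge0.
have Ml : 0 <= M * l by rewrite mulr_ge0.
have cpt : continuous (fun x => phi x * theta x).
  by move=> x; exact: (cvgM (cphi x) (cth x)).
have me := measurable_abs_EFin ceta.
have mi := measurable_gagliardo_inner s ceta.
have i0 f x : (0 <= \int[leb]_y (`|f x - f y| * frac_kernel s x y)%:E)%E.
  by apply: integral_ge0 => y _; exact: gagliardo_integrand_ge0.
have nA x : (0 <= (l * C)%:E * `|eta x|%:E)%E by rewrite mule_ge0.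
have nB x : (0 <= (M * l)%:E * \int[leb]_y (`|eta x - eta y| * frac_kernel s x y)%:E)%E.
  by rewrite mule_ge0.
have mA := measurable_funeM (l * C)%:E me.
have mB := measurable_funeM (M * l)%:E mi.
rewrite -!ge0_integralZl_EFin// -ge0_integralD//.
apply: ge0_le_integral => //.
- by move=> x _; exact: (i0 (fun x => phi x * theta x)).
- exact: (measurable_gagliardo_inner s cpt).
- exact: emeasurable_funD.
move=> x _.
have mphi := measurable_gagliardo_section s x cphi.
have meta := measurable_gagliardo_section s x ceta.
have nphi y : (0 <= (l * `|eta x|)%:E * (`|phi x - phi y| * frac_kernel s x y)%:E)%E.
  by rewrite mule_ge0 ?gagliardo_integrand_ge0// lee_fin mulr_ge0.
have neta y : (0 <= (M * l)%:E * (`|eta x - eta y| * frac_kernel s x y)%:E)%E.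
  by rewrite mule_ge0 ?gagliardo_integrand_ge0.
have mphi' := measurable_funeM (l * `|eta x|)%:E mphi.
have meta' := measurable_funeM (M * l)%:E meta.
apply: (@le_trans _ _ (\int[leb]_y ((l * `|eta x|)%:E * (`|phi x - phi y| * frac_kernel s x y)%:E
   + (M * l)%:E * (`|eta x - eta y| * frac_kernel s x y)%:E))%E).
  apply: ge0_le_integral => //.
  - by move=> y _; exact: (gagliardo_integrand_ge0 s (fun x => phi x * theta x)).
  - exact: (measurable_gagliardo_section s x cpt).
  - exact: emeasurable_funD.
  - move=> y _; rewrite -!EFinM -EFinD lee_fin !mulrA -mulrDl.
    rewrite ler_wpM2r ?frac_kernel_ge0//.
    have -> : phi x * theta x - phi y * theta y =
      theta x * (phi x - phi y) + phi y * (theta x - theta y) by ring.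
    apply: le_trans (ler_normD _ _) _; rewrite !normrM lerD// ?ler_wpM2r//.
    by rewrite -mulrA ler_pM.
rewrite ge0_integralD// !ge0_integralZl_EFin//; last 3 first.
- by move=> y _; exact: gagliardo_integrand_ge0.
- by move=> y _; exact: gagliardo_integrand_ge0.
- by rewrite mulr_ge0.
apply: leeD => //.
apply: le_trans (lee_wpmul2l _ (HC x)) _; first by rewrite lee_fin mulr_ge0.
by rewrite -!EFinM lee_fin mulrAC.
Qed.

(** The integrand vanishes unless [x] or [y] lies in the support; by symmetry of
    the kernel both cases give the same finite integral. *)
Lemma gagliardo_lty s phi (C r : R) : continuous phi -> 0 < r -> 0 <= C ->
  (forall x, (\int[leb]_y (`|phi x - phi y| * frac_kernel s x y)%:E <= C%:E)%E) ->
  (forall x, ~ cube 0 r x -> phi x = 0) -> (gagliardo s phi < +oo)%E.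
Proof.
move=> cphi r0 C0 HC Hr.
pose S : set 'rV[R]_n := cube 0 r.
have mS : measurable S := @measurable_cube R n 0 r.
pose g (p : 'rV[R]_n * 'rV[R]_n) : \bar R := (`|phi p.1 - phi p.2| * frac_kernel s p.1 p.2)%:E.
have mg : measurable_fun setT g by exact: measurable_gagliardo_integrand.
have g0 p : (0 <= g p)%E by exact: gagliardo_integrand_ge0.
have mS1 : measurable_fun setT (fun x => (\1_S x)%:E : \bar R).
  exact/measurable_EFinP/measurable_indic.
pose g1 p := ((\1_S p.1)%:E * g p)%E.
pose g2 p := ((\1_S p.2)%:E * g p)%E.
have mg1 : measurable_fun setT g1.
  by apply: emeasurable_funM => //; exact: (measurableT_comp mS1 measurable_fst).
have mg2 : measurable_fun setT g2.
  by apply: emeasurable_funM => //; exact: (measurableT_comp mS1 measurable_snd).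
have g10 p : (0 <= g1 p)%E by rewrite mule_ge0// lee_fin.
have g20 p : (0 <= g2 p)%E by rewrite mule_ge0// lee_fin.
have g12 p : (g p <= g1 p + g2 p)%E.
  have : p.1 \notin S -> p.2 \notin S -> g p = 0%E.
    rewrite !notin_setE /g => xS yS.
    by rewrite (Hr _ xS) (Hr _ yS) subrr normr0 mul0r.
  rewrite /g1 /g2 !indicE.
  move: (g p) (g0 p) (p.1 \in S) (p.2 \in S) => G G0 [] [] H.
  - by rewrite !mul1e leeDl.
  - by rewrite mul1e mul0e adde0.
  - by rewrite mul1e mul0e add0e.
  - by rewrite !mul0e add0e H.
have I1 : (\int[leb]_x \int[leb]_y g1 (x, y) <= C%:E * ((2 * r) ^+ n)%:E)%E.
  rewrite -[X in (_ * X)%E](lebesgue_rV_cube 0 r0) -integral_cst// integral_mkcond.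
  apply: ge0_le_integral => //.
  - by move=> x _; exact: integral_ge0.
  - exact: (measurable_fun_fubini_tonelli_F g1).
  - have mk : measurable_fun S (cst C%:E : _ -> \bar R) by exact: measurable_cst.
    exact: (measurable_restrictT _ mS).1 mk.
  move=> x _; rewrite /g1/= patchE indicE; case: ifPn => xS.
    by under eq_integral do rewrite mul1e; exact: HC.
  by under eq_integral do rewrite mul0e; rewrite integral0.
have I2 : (\int[leb]_x \int[leb]_y g2 (x, y) = \int[leb]_x \int[leb]_y g1 (x, y))%E.
  rewrite [LHS](fubini_tonelli g2 mg2 g20); apply: eq_integral => y _; apply: eq_integral => x _.
  by rewrite /g1 /g2 /g/= distrC frac_kernelC.
have g120 p : (0 <= g1 p + g2 p)%E by rewrite adde_ge0.
have mg12 : measurable_fun setT (fun p => g1 p + g2 p)%E by exact: emeasurable_funD.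
rewrite -[gagliardo s phi]/(\int[leb]_x \int[leb]_y g (x, y))%E.
apply: (@le_lt_trans _ _ (\int[leb]_x \int[leb]_y (g1 (x, y) + g2 (x, y)))%E).
  apply: ge0_le_integral.
  - exact: measurableT.
  - by move=> x _; apply: integral_ge0 => y _; exact: g0.
  - exact: (measurable_fun_fubini_tonelli_F g mg g0).
  - exact: (measurable_fun_fubini_tonelli_F (fun p => g1 p + g2 p)%E mg12 g120).
  move=> x _; apply: ge0_le_integral.
  - exact: measurableT.
  - by move=> y _; exact: g0.
  - exact: (measurableT_comp mg (measurable_pair1 x)).
  - exact: (measurableT_comp mg12 (measurable_pair1 x)).
  by move=> y _; exact: g12.
rewrite -[ltLHS](fubini_tonelli1 (fun p => g1 p + g2 p)%E mg12 g120).
rewrite (ge0_integralD _ measurableT (fun p _ => g10 p) mg1 (fun p _ => g20 p) mg2).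
rewrite (fubini_tonelli1 g1 mg1 g10) (fubini_tonelli1 g2 mg2 g20) /fubini_F I2.
by apply: lte_add_pinfty; apply: le_lt_trans I1 _; rewrite -EFinM ltry.
Qed.

End gagliardo.

(** * Integrable times bounded and small in mean *)

Section uniform_integrability.
Context d (T : measurableType d) (R : realType) (mu : {measure set T -> \bar R}).

Lemma integral_truncation_tail (f : T -> R) (e : R) :
  mu.-integrable setT (EFin \o f) -> (forall x, 0 <= f x) -> 0 < e ->
  exists m : nat, (\int[mu]_x (f x - Num.min (f x) m%:R)%:E < e%:E)%E.
Proof.
move=> intf f0 e0.
have mf : measurable_fun setT f by apply/measurable_EFinP; exact: measurable_int intf.
pose g (m : nat) x : \bar R := (f x - Num.min (f x) m%:R)%:E.
have mg m : measurable_fun setT (g m).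
  apply/measurable_EFinP; apply: measurable_funB => //.
  exact: measurable_minr.
have g0 m x : 0 <= f x - Num.min (f x) m%:R by rewrite subr_ge0 ge_min lexx.
have : (\int[mu]_x g m x)%E @[m --> \oo] --> (\int[mu]_x (cst 0%E) x)%E.
  apply: (@dominated_cvg _ _ _ _ _ measurableT g (cst 0%E) (EFin \o f)) => //.
  - move=> x _; apply: cvg_near_cst.
    exists (Num.truncn (f x)).+1 => // m /= km.
    have /andP[_ fk] := truncn_itv (f0 x).
    rewrite /g min_l ?subrr//; apply: le_trans (ltW fk) _.
    by rewrite ler_nat.
  - move=> m x _; rewrite gee0_abs ?lee_fin ?g0//= lerBlDl lerDr.
    by rewrite le_min f0 ler0n.
rewrite integral0 => /fine_cvgP[fing /cvgr_lt /(_ _ e0)] lt.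
have [m [Fm Lm]] := filter_ex (filterI fing lt).
by exists m; rewrite -(fineK Fm) lte_fin.
Qed.

(** Split [f] at the height [M]: the part above [M] has a small integral, and the
    part below is multiplied by a function of small integral. *)
Lemma integral_mul_le_bounded (f : T -> R) (b e : R) :
  mu.-integrable setT (EFin \o f) -> (forall x, 0 <= f x) -> 0 <= b -> 0 < e ->
  exists2 M : R, 0 <= M & forall theta : T -> R, measurable_fun setT theta ->
    (forall x, `|theta x| <= b) ->
    (\int[mu]_x (f x * `|theta x|)%:E <= e%:E + M%:E * \int[mu]_x `|theta x|%:E)%E.
Proof.
move=> intf f0 b0 e0.
have e1 : 0 < e / (b + 1) by rewrite divr_gt0// ltr_wpDl.
have [m /ltW Hm] := integral_truncation_tail intf f0 e1.
have mf : measurable_fun setT f by apply/measurable_EFinP; exact: measurable_int intf.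
exists m%:R => // theta mth bth.
have mg : measurable_fun setT (fun x => (f x - Num.min (f x) m%:R)%:E).
  apply/measurable_EFinP; apply: measurable_funB => //.
  exact: measurable_minr.
have g0 x : (0 <= (f x - Num.min (f x) m%:R)%:E)%E by rewrite lee_fin subr_ge0 ge_min lexx.
have mt : measurable_fun setT (fun x => `|theta x|%:E).
  by apply/measurable_EFinP; exact: measurableT_comp.
apply: (@le_trans _ _ (\int[mu]_x (b%:E * (f x - Num.min (f x) m%:R)%:E + m%:R%:E * `|theta x|%:E))%E).
  apply: ge0_le_integral => //.
  - by move=> x _; rewrite lee_fin mulr_ge0.
  - by apply/measurable_EFinP; apply: measurable_funM => //; exact: measurableT_comp.
  - by apply: emeasurable_funD; exact: measurable_funeM.
  - move=> x _; rewrite -!EFinM -EFinD lee_fin.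
    rewrite -[X in X * _ <= _](subrK (Num.min (f x) m%:R)) mulrDl; apply: lerD.
      by rewrite mulrC ler_wpM2r// subr_ge0 ge_min lexx.
    by rewrite ler_wpM2r// ge_min lexx orbT.
have nA x : (0 <= b%:E * (f x - Num.min (f x) m%:R)%:E)%E by rewrite mule_ge0.
have nB x : (0 <= m%:R%:E * `|theta x|%:E)%E by rewrite mule_ge0.
have mA := measurable_funeM b%:E mg.
have mB := measurable_funeM m%:R%:E mt.
rewrite ge0_integralD// !ge0_integralZl_EFin//; apply: leeD => //.
apply: le_trans (lee_wpmul2l _ Hm) _; first by rewrite lee_fin.
rewrite -EFinM lee_fin mulrA ler_pdivrMr ?ltr_wpDl//.
by rewrite mulrDr mulr1 [b * e]mulrC lerDl ltW.
Qed.

End uniform_integrability.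

(** * Capacity zero *)

Section capacity.
Context {R : realType} {n : nat}.
Implicit Types (F S E U Omega : set 'rV[R]_n).
Local Notation leb := (lebesgue_rV R n).

(** The open set [G] supplied by the outer capacity has small inner capacity, which
    is used for a compact neighbourhood of [S] inside [G]. *)
Lemma cap_zero_test_fun (s d : R) E U S : cap_zero s E -> open U -> compact S ->
  S `<=` E `&` U -> 0 < d -> exists eta F,
  [/\ test_fun U eta, S `<=` F°, forall x, F x -> 1 <= eta x & (gagliardo s eta < d%:E)%E].
Proof.
move=> /(_ U) capE oU cS SE d0.
have : (cap s (E `&` U) U < d%:E)%E by rewrite capE// lte_fin.
move=> /ereal_inf_lt[_ [G [oG EG GU] <-] Gd].
have [F [cF SF FG]] := compact_nbhs_between cS oG (subset_trans SE EG).
have : (cap_compact s F U < d%:E)%E.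
  by apply: le_lt_trans Gd; apply: ereal_sup_ubound; exists F.
move=> /ereal_inf_lt[_ [eta [teta eta1] <-] etad].
by exists eta, F.
Qed.

End capacity.

(** * The nonlocal term *)

Section weak_form.
Context {R : realType} {n : nat}.
Implicit Types (u B phi psi eta : 'rV[R]_n -> R) (A : 'rV[R]_n -> 'rV[R]_n -> R -> R).
Implicit Types (F S E U Omega : set 'rV[R]_n).
Local Notation leb := (lebesgue_rV R n).

(** A Borel representative of [u] is inserted into [A]; truncating the result at
    [Lam] changes it on a null set only. *)
Lemma bounded_borel_flux A u : structural_conditions A -> completed_measurable_fun leb setT u ->
  exists (Lam : R) (W : 'rV[R]_n * 'rV[R]_n -> R), [/\ 0 < Lam, measurable_fun setT W,
    forall p, `|W p| <= Lam &
    \forall p \ae (leb \x leb)%E, A p.1 p.2 ((u p.1 - u p.2) / enorm (p.1 - p.2)) = W p].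
Proof.
move=> [[mA cA] _ _ [Lam Lam0 bA] _] mu.
have [g mg ug] := completed_measurable_fun_ae mu.
pose w (p : 'rV[R]_n * 'rV[R]_n) := (g p.1 - g p.2) / enorm (p.1 - p.2).
have mw : measurable_fun setT w.
  apply: measurable_funM.
    apply: measurable_funB.
    - exact: (measurableT_comp mg measurable_fst).
    - exact: (measurableT_comp mg measurable_snd).
  rewrite (_ : (fun _ => _) = (fun p : 'rV[R]_n * 'rV[R]_n => enorm (p.1 - p.2) `^ (-1))).
    exact: (measurableT_comp (measurable_powR _) (@measurable_enormB R n)).
  by apply/funext => p; rewrite powR_inv1// sqrtr_ge0.
have [W mW AW] := caratheodory_comp_ae (F := fun p t => A p.1 p.2 t) mA cA mw.
exists Lam, (fun p => Num.max (- Lam) (Num.min Lam (W p))); split => //.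
- by apply: measurable_maxr => //; exact: measurable_minr.
- move=> p; rewrite ler_norml le_max lexx/= ge_max ge_min lexx/= andbT.
  by apply: (@le_trans _ _ 0); rewrite ?oppr_le0 ltW.
have ug1 := @ae_prod_fst _ _ _ _ _ leb leb _ ug.
have ug2 := @ae_prod_snd _ _ _ _ _ leb leb _ ug.
near=> p.
have -> : u p.1 = g p.1 by move: I; near: p; exact: ug1.
have -> : u p.2 = g p.2 by move: I; near: p; exact: ug2.
have Ap : A p.1 p.2 (w p) = W p by near: p.
have : `|A p.1 p.2 (w p)| <= Lam by move: (w p); near: p.
rewrite -/(w p) Ap ler_norml => /andP[W1 W2].
by rewrite min_r// max_r.
Unshelve. all: by end_near. Qed.

Section flux.
Variables (s Lam : R) (W : 'rV[R]_n * 'rV[R]_n -> R).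
Hypotheses (mW : measurable_fun setT W) (bW : forall p, `|W p| <= Lam).

Definition flux_form psi (p : 'rV[R]_n * 'rV[R]_n) : \bar R :=
  (W p * (psi p.1 - psi p.2) * frac_kernel s p.1 p.2)%:E.

Lemma measurable_flux_form psi : continuous psi -> measurable_fun setT (flux_form psi).
Proof.
move=> /continuous_measurable_rV mf; apply/measurable_EFinP.
apply: measurable_funM; last exact: measurable_frac_kernel.
apply: measurable_funM => //; apply: measurable_funB.
- exact: (measurableT_comp mf measurable_fst).
- exact: (measurableT_comp mf measurable_snd).
Qed.

Lemma integral_abs_flux_form_le psi : 0 < Lam -> continuous psi ->
  (\int[leb]_x \int[leb]_y `|flux_form psi (x, y)| <= Lam%:E * gagliardo s psi)%E.
Proof.
move=> Lam0 cpsi.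
have mpsi := measurable_flux_form cpsi.
have ma : measurable_fun setT (fun p => `|flux_form psi p|%E).
  exact: measurableT_comp.
have i0 x : (0 <= \int[leb]_y (`|psi x - psi y| * frac_kernel s x y)%:E)%E.
  by apply: integral_ge0 => y _; exact: gagliardo_integrand_ge0.
have mi := measurable_gagliardo_inner s cpsi.
rewrite /gagliardo -(ge0_integralZl_EFin _ measurableT (fun x _ => i0 x) mi (ltW Lam0)).
apply: ge0_le_integral.
- exact: measurableT.
- by move=> x _; apply: integral_ge0 => y _.
- exact: (measurable_fun_fubini_tonelli_F (fun p => `|flux_form psi p|%E)).
- exact: measurable_funeM.
move=> x _.
have mg := measurable_gagliardo_section s x cpsi.
have g0 y (_ : setT y) := gagliardo_integrand_ge0 s psi x y.
rewrite -(ge0_integralZl_EFin _ measurableT g0 mg (ltW Lam0)).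
apply: ge0_le_integral.
- exact: measurableT.
- by move=> y _.
- exact: (measurableT_comp ma (measurable_pair1 x)).
- exact: measurable_funeM.
move=> y _; rewrite /flux_form /= -EFinM lee_fin !normrM -mulrA.
by rewrite (ger0_norm (frac_kernel_ge0 _ _ _)) ler_wpM2r// mulr_ge0 ?frac_kernel_ge0.
Qed.

Lemma integrable_flux_form psi : 0 < Lam -> continuous psi -> (gagliardo s psi < +oo)%E ->
  (leb \x leb)%E.-integrable setT (flux_form psi).
Proof.
move=> Lam0 cpsi gpsi; apply/integrable12ltyP; first exact: measurable_flux_form.
apply: le_lt_trans (integral_abs_flux_form_le Lam0 cpsi) _.
by apply: lte_mul_pinfty => //; rewrite lee_fin ltW.
Qed.

Lemma abs_integral_flux_form_le psi : 0 < Lam -> continuous psi ->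
  (`|\int[leb \x leb]_p flux_form psi p| <= Lam%:E * gagliardo s psi)%E.
Proof.
move=> Lam0 cpsi; have mpsi := measurable_flux_form cpsi.
apply: le_trans (le_abse_integral _ measurableT mpsi) _.
rewrite (fubini_tonelli1 (fun p => `|flux_form psi p|%E)) //.
  exact: integral_abs_flux_form_le.
exact: measurableT_comp.
Qed.

End flux.
End weak_form.

(** * Test functions have finite seminorm *)

Section test_functions.
Context {R : realType} {n : nat}.
Implicit Types (phi : 'rV[R]_n -> R) (U V : set 'rV[R]_n).
Local Notation leb := (lebesgue_rV R n).

Lemma test_funS U V : U `<=` V -> test_fun U `<=` test_fun V.
Proof. by move=> UV phi [? ? phiU]; split => //; exact: subset_trans phiU UV. Qed.

Lemma test_fun_ball U phi : test_fun U phi ->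
  exists2 r : R, 0 < r & fsupport phi `<=` ball 0 r.
Proof.
move=> [_ cphi _].
have [r r0 Hr] := compact_norm_le cphi; exists (r + 1); first by rewrite addr_gt0.
move=> x /Hr xr; rewrite -ball_normE /= sub0r normrN.
by apply: le_lt_trans xr _; rewrite ltrDl.
Qed.

Lemma fsupport_ball_eq0 phi r x : 0 < r -> fsupport phi `<=` ball 0 r ->
  ~ cube 0 r x -> phi x = 0.
Proof.
move=> r0 phiU ncx; apply: notin_fsupport => /phiU.
by rewrite -ball_normE /= sub0r normrN => xr; apply: ncx; apply/cubeE => //; rewrite subr0.
Qed.

Lemma test_fun_kernel_integral s U phi : 0 < s < 1 -> test_fun U phi ->
  exists2 C : R, 0 <= C &
    forall x, (\int[leb]_y (`|phi x - phi y| * frac_kernel s x y)%:E <= C%:E)%E.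
Proof.
move=> s01 tphi.
have [M M0 HM] := test_fun_bounded tphi.
have [L L0 HL] := test_fun_lipschitz tphi.
have [sphi _ _] := tphi.
apply: (@lipschitz_bounded_kernel_integral R n s phi L (M + M)) => //.
- exact: ltW.
- by rewrite addr_ge0// ltW.
- exact: smooth_continuous.
- by move=> x y; apply: le_trans (ler_normB _ _) _; exact: lerD.
Qed.

Lemma test_fun_gagliardo_lty s U phi : 0 < s < 1 -> test_fun U phi ->
  (gagliardo s phi < +oo)%E.
Proof.
move=> s01 tphi; have [C C0 HC] := test_fun_kernel_integral s01 tphi.
have [r r0 Hr] := test_fun_ball tphi; have [sphi _ _] := tphi.
apply: (gagliardo_lty (smooth_continuous sphi) r0 C0 HC) => x.
exact: fsupport_ball_eq0.
Qed.

End test_functions.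

(** * The source term *)

Section source.
Context {R : realType} {n : nat}.
Implicit Types (B b phi : 'rV[R]_n -> R) (U Omega : set 'rV[R]_n).
Local Notation leb := (lebesgue_rV R n).

Lemma integral_source U Omega B b phi : U `<=` Omega -> test_fun U phi ->
  (\forall x \ae leb, Omega x -> B x = b x) ->
  (\int[leb]_(x in U) (B x * phi x)%:E = \int[leb]_x (b x * phi x)%:E)%E.
Proof.
move=> UO [_ _ phiU] Bb; rewrite integral_mkcond; apply: integral_ae_congr.
apply: filterS Bb => x Bb; rewrite patchE; case: ifPn.
  by rewrite inE => /UO /Bb ->.
rewrite notin_setE => Ux; rewrite (@notin_fsupport _ _ phi) ?mulr0//.
by move=> /phiU.
Qed.

Lemma integrable_source Omega B b phi : locally_integrable_rV Omega B ->
  measurable_fun setT b -> (\forall x \ae leb, Omega x -> B x = b x) ->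
  test_fun Omega phi -> leb.-integrable setT (fun x => (b x * phi x)%:E).
Proof.
move=> [_ locB] mb Bb tphi; have [sphi cK KO] := tphi.
have [M M0 HM] := test_fun_bounded tphi.
have mphi := continuous_measurable_rV (smooth_continuous sphi).
have mbphi : measurable_fun setT (fun x => (b x * phi x)%:E).
  by apply/measurable_EFinP; exact: measurable_funM.
apply/integrableP; split => //.
set K := fsupport phi in cK KO.
have mK : measurable K.
  rewrite -(setCK K); apply: measurableC; apply: open_measurable_rV.
  by apply: closed_openC; exact: closed_closure.
have mbK : measurable_fun K (fun x => `|b x|%:E).
  by apply: measurable_funTS; apply/measurable_EFinP; exact: measurableT_comp.
have -> : (\int[leb]_x `|(b x * phi x)%:E| = \int[leb]_(x in K) `|(b x * phi x)%:E|)%E.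
  rewrite [RHS]integral_mkcond; apply: eq_integral => x _; rewrite patchE.
  by case: ifPn => //; rewrite notin_setE => /notin_fsupport ->; rewrite mulr0 abse0.
apply: (@le_lt_trans _ _ (\int[leb]_(x in K) (M%:E * `|b x|%:E))%E).
  apply: ge0_le_integral => //.
  - by apply: measurable_funTS; exact: measurableT_comp.
  - exact: measurable_funeM.
  - by move=> x _; rewrite -EFinM lee_fin normrM mulrC ler_wpM2r.
rewrite ge0_integralZl_EFin//; last exact: ltW.
rewrite (_ : \int[leb]_(x in K) _ = \int[leb]_(x in K) `|B x|%:E)%E.
  by apply: lte_mul_pinfty; [rewrite lee_fin ltW|by []|exact: locB].
apply: integral_ae_congr_in; apply: filterS Bb => x Bb Kx.
by rewrite Bb//; exact: KO.
Qed.

End source.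

(** * Removability *)

Unset Implicit Arguments.

Theorem theorem5p1 (R : realType) (n : nat) (hn : (0 < n)%N)
  (s : R) (hs0 : 0 < s) (hs1 : s < 1)
  (A : 'rV[R]_n -> 'rV[R]_n -> R -> R) (hA : structural_conditions A)
  (Omega : set 'rV[R]_n) (hOmega : open Omega)
  (E : set 'rV[R]_n)
  (hE : exists2 C : set 'rV[R]_n, closed C & E = Omega `&` C)
  (hcap : cap_zero s E)
  (B : 'rV[R]_n -> R) (hB : locally_integrable_rV Omega B)
  (u : 'rV[R]_n -> R) (hu : weak_solution s A B (Omega `\` E) u) :
  exists v : 'rV[R]_n -> R,
    (\forall x \ae lebesgue_rV R n, v x = u x) /\ weak_solution s A B Omega v.
Proof.
exists u; split; first exact: aeW.
have [mu wu] := hu; split => // phi tphi.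
set leb := lebesgue_rV R n in wu *.
have [Lam [W [Lam0 mW bW AW]]] := bounded_borel_flux hA mu.
have [mB _] := hB.
have [b mb Bb] := completed_measurable_fun_ae mB.
have [sphi cphi phiO] := tphi.
have cont := smooth_continuous sphi.
pose I psi := (\int[leb \x leb]_p flux_form s W psi p)%E.
pose J psi := (\int[leb]_x (b x * psi x)%:E)%E.
have fluxE psi : continuous psi -> (gagliardo s psi < +oo)%E ->
    (\int[leb]_x \int[leb]_y (A x y ((u x - u y) / enorm (x - y)) * (psi x - psi y)
      * frac_kernel s x y)%:E = I psi)%E.
  move=> cpsi gpsi.
  rewrite /I -(integral12_prod_meas1 (integrable_flux_form mW bW Lam0 cpsi gpsi)).
  apply: (iterated_integral_ae_congr (m1 := leb) (m2 := leb)
    (f := fun p => (A p.1 p.2 ((u p.1 - u p.2) / enorm (p.1 - p.2)) * (psi p.1 - psi p.2)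
      * frac_kernel s p.1 p.2)%:E)
    (g := flux_form s W psi)).
  by apply: filterS AW => p Ep; rewrite /flux_form -Ep.
have [M M0 HM] := test_fun_bounded tphi.
have s01 : 0 < s < 1 by rewrite hs0.
have [C C0 HC] := test_fun_kernel_integral s01 tphi.
have [r r0 Hr] := test_fun_ball tphi.
have gphi := test_fun_gagliardo_lty s01 tphi.
have iphi := integrable_flux_form mW bW Lam0 cont gphi.
have jphi := integrable_source hB mb Bb tphi.
rewrite fluxE// (integral_source (fun x => id) tphi Bb) -/(J phi).
have Ifin : I phi \is a fin_num by exact: integrable_fin_num iphi.
have Jfin : J phi \is a fin_num by exact: integrable_fin_num jphi.
apply/eqP; rewrite -abse_eq0 eq_le abse_ge0 andbT; apply/lee_addgt0Pr => e e0.
rewrite add0e.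
have e2 : 0 < e / 2 by rewrite divr_gt0.
pose be := 1 + expR 1 : R.
have japhi : leb.-integrable setT (EFin \o (fun x => `|b x * phi x|)).
  exact: (integrable_abse jphi).
have be0 : 0 <= be by rewrite addr_ge0// expR_ge0.
(* chosen before [eta]: it depends on [phi] and [e] only *)
have [N N0 HN] := integral_mul_le_bounded japhi (fun x => normr_ge0 _) be0 e2.
have [c c0 Hc] := @L1_le_gagliardo R n s r hn hs0 r0.
pose l := 2 * expR 1 : R.
have l0 : 0 <= l by rewrite mulr_ge0// expR_ge0.
(* the total error is at most [e / 2] plus [D] times the seminorm of [eta] *)
pose D := N * (l * c) + Lam * (l * C * c + M * l) + 1.
have D0 : 0 < D.
  by rewrite ltr_pwDr// addr_ge0 ?mulr_ge0 ?addr_ge0 ?mulr_ge0// ltW.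
have dD : 0 < e / 2 / D by rewrite divr_gt0.
have oball : open (ball (0 : 'rV[R]_n) r) by exact: ball_open.
have [K [Kcl EK]] : exists K, closed K /\ E = Omega `&` K.
  by case: hE => K ? ?; exists K.
have cS : compact (E `&` fsupport phi).
  have -> : E `&` fsupport phi = K `&` fsupport phi.
    rewrite EK -setIA (setIC Omega) -setIA; congr (_ `&` _).
    by apply/seteqP; split => x /=; [case|move=> px; split => //; exact: phiO].
  apply: subclosed_compact cphi _; last by move=> x [].
  by apply: closedI => //; exact: closed_closure.
have [eta [F [teta SF F1 geta]]] : exists eta F,
  [/\ test_fun (ball 0 r) eta, E `&` fsupport phi `<=` F°, forall x, F x -> 1 <= eta x
    & (gagliardo s eta < (e / 2 / D)%:E)%E].
  apply: cap_zero_test_fun hcap oball cS _ dD.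
  by move=> x [Ex px]; split => //; exact: Hr.
have [seta _ _] := teta.
have ceta := smooth_continuous seta.
pose theta x := 1 - cutoff eta x.
have tphik := test_fun_cutoff tphi seta SF F1.
set phik := (fun x => phi x * cutoff eta x) in tphik.
pose rest x := phi x * theta x.
have cthe : continuous theta.
  have cc := smooth_continuous (flat_closure_is_smooth (cutoff_smooth seta)).
  by move=> x; exact: (cvgB (cvg_cst _) (cc x)).
have crest : continuous rest by move=> x; exact: (cvgM (cont x) (cthe x)).
have [g [g0 gE gD]] : exists g : R, [/\ 0 <= g, gagliardo s eta = g%:E & g < e / 2 / D].
  have ge0 : (0 <= gagliardo s eta)%E.
    by apply: integral_ge0 => x _; apply: integral_ge0 => y _; exact: gagliardo_integrand_ge0.
  have gf : gagliardo s eta \is a fin_num by rewrite ge0_fin_numE// (lt_trans geta)// ltry.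
  exists (fine (gagliardo s eta)); rewrite fineK//; split => //.
    exact: fine_ge0.
  by rewrite -lte_fin fineK.
have L1eta : (\int[leb]_x `|eta x|%:E <= (c * g)%:E)%E.
  rewrite EFinM -gE; apply: Hc ceta _ => x; apply: fsupport_ball_eq0 => //.
  by case: teta.
have thl x y : `|theta x - theta y| <= l * `|eta x - eta y|.
  have -> : theta x - theta y = - (cutoff eta x - cutoff eta y) by rewrite /theta; ring.
  by rewrite normrN; exact: cutoff_lipschitz.
have grest : (gagliardo s rest <= ((l * C * c + M * l) * g)%:E)%E.
  apply: le_trans (gagliardo_product_le cont cthe ceta C0 (ltW M0) l0 HC HM
    (cutoff_le eta) thl) _.
  rewrite gE mulrDl EFinD -mulrA [(l * C * _)%:E]EFinM [(M * l * g)%:E]EFinM.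
  by apply: leeD => //; apply: lee_wpmul2l => //; rewrite lee_fin mulr_ge0.
have mthe := continuous_measurable_rV cthe.
have L1the : (\int[leb]_x `|theta x|%:E <= (l * c * g)%:E)%E.
  apply: (@le_trans _ _ (\int[leb]_x (l%:E * `|eta x|%:E))%E).
    apply: ge0_le_integral => //.
    - exact: measurable_abs_EFin.
    - by apply: measurable_funeM; exact: measurable_abs_EFin.
    - by move=> x _; rewrite -EFinM lee_fin; exact: cutoff_le.
  rewrite ge0_integralZl_EFin//; last exact: measurable_abs_EFin.
  by rewrite -mulrA [leRHS]EFinM; apply: lee_wpmul2l.
have absJ : (\int[leb]_x `|(b x * rest x)%:E| <= (e / 2 + N * (l * c * g))%:E)%E.
  rewrite (_ : \int[leb]_x _ = \int[leb]_x (`|b x * phi x| * `|theta x|)%:E)%E.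
    apply: le_trans (HN theta mthe (cutoff_bounded eta)) _.
    by rewrite EFinD [(N * _)%:E]EFinM; apply: leeD => //; apply: lee_wpmul2l.
  by apply: eq_integral => x _; rewrite /rest mulrA -normrM.
have jrest : leb.-integrable setT (fun x => (b x * rest x)%:E).
  apply/integrableP; split; last by apply: le_lt_trans absJ _; rewrite ltry.
  apply/measurable_EFinP; apply: measurable_funM => //.
  exact: continuous_measurable_rV.
have [sphik _ _] := tphik.
have contk := smooth_continuous sphik.
have gphik := test_fun_gagliardo_lty s01 tphik.
have iphik := integrable_flux_form mW bW Lam0 contk gphik.
have irest : (leb \x leb)%E.-integrable setT (flux_form s W rest).
  exact: (integrable_flux_form mW bW Lam0 crest (le_lt_trans grest (ltry _))).
have jphik := integrable_source hB mb Bb (test_funS (@subDsetl _ Omega E) tphik).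
have phiE x : phi x = phik x + rest x by rewrite /phik /rest /theta; ring.
have IE : (I phi = I phik + I rest)%E.
  rewrite /I -integralD//; apply: eq_integral => p _.
  by rewrite /flux_form -EFinD !phiE; congr (_%:E); ring.
have JE : (J phi = J phik + J rest)%E.
  rewrite /J -integralD//; apply: eq_integral => x _.
  by rewrite -EFinD phiE mulrDr.
have weakk : (I phik + J phik = 0)%E.
  have := wu _ tphik; rewrite fluxE//.
  by rewrite (integral_source (@subDsetl _ Omega E) tphik Bb).
rewrite IE JE addeACA weakk add0e.
apply: le_trans (lee_abs_add _ _) _.
apply: (@le_trans _ _ ((Lam * ((l * C * c + M * l) * g))%:E + (e / 2 + N * (l * c * g))%:E)%E).
  apply: leeD.
    apply: (le_trans (abs_integral_flux_form_le s mW bW Lam0 crest)).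
    by rewrite [leRHS]EFinM; apply: lee_wpmul2l => //; rewrite lee_fin ltW.
  apply: le_trans (le_abse_integral _ measurableT _) absJ.
  exact: measurable_int jrest.
rewrite -EFinD lee_fin.
have : g * D <= e / 2 by rewrite -ler_pdivlMr// ltW.
rewrite (_ : Lam * _ + _ = e / 2 + (g * D - g)); last by rewrite /D; ring.
lra.
Qed.
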